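(* Let $G$ be a countable discrete amenable group which is Hilbert--Schmidt stable, and let $N$ be any abelian normal subgroup of $G$. Then the topological dynamical system $(G,\widehat{N})$, where $\widehat{N}$ is the Pontryagin dual of $N$ with the dual conjugation action of $G$, has dense periodic measures.
   Context: Hilbert--Schmidt stability: for $A,B\in \mathrm{U}(n)$ (the unitary group of degree $n$) put $d_{\mathrm{HS}}(A,B)=\sqrt{\tfrac1n \mathrm{tr}((A-B)^*(A-B))}$. An asymptotic homomorphism of a discrete group $G$ is a sequence of maps $f_n:G\to \mathrm{U}(n)$, $n\in\mathbb{N}$, with $d_{\mathrm{HS}}(f_n(g)f_n(h),f_n(gh))\to 0$ as $n\to\infty$ for all $g,h\in G$. The group $G$ is Hilbert--Schmidt stable if for any asymptotic homomorphism $(f_n)$ there are group homomorphisms $\varphi_n:G\to \mathrm{U}(n)$ with $d_{\mathrm{HS}}(f_n(g),\varphi_n(g))\to0$ for all $g\in G$. Dense periodic measures: a topological dynamical system $(G,X)$ is a discrete group $G$ acting by homeomorphisms on a compact metrizable space $X$. It has dense periodic measures if every $G$-invariant Borel probability measure on $X$ is a weak-$*$ limit of $G$-invariant probability measures with finite supports. Dual action: $G$ acts on $\widehat{N}$ by continuous automorphisms via $\chi^g(n)=\chi(g^{-1}ng)$ for $g\in G$, $n\in N$, $\chi\in\widehat N$. *)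

(* Defs.v *)
From HB Require Import structures.
From mathcomp Require Import all_boot all_order all_algebra.
From mathcomp Require Import all_classical all_reals all_analysis.
From mathcomp Require Import complex spectral lra.

Set Implicit Arguments.
Unset Strict Implicit.
Unset Printing Implicit Defensive.

Import Order.TTheory GRing.Theory Num.Theory.
Import numFieldNormedType.Exports.

Local Open Scope classical_set_scope.
Local Open Scope ring_scope.
Local Open Scope sesquilinear_scope.

Section Amenability.
Context (R : realType) (G : groupType).

(* Only the values of m on bounded functions are constrained, so that m is a
   functional on l^oo(G). *)
Record invariant_mean (m : (G -> R) -> R) : Prop := InvariantMean {
  mean_linear : forall (a : R) (u v : G -> R), bounded_fun u -> bounded_fun v ->
    m (fun x => a * u x + v x) = a * m u + m v;
  mean_ge0 : forall u : G -> R, bounded_fun u ->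
    (forall x, 0 <= u x) -> 0 <= m u;
  mean1 : m (fun=> 1) = 1;
  mean_translate : forall (g : G) (u : G -> R), bounded_fun u ->
    m (fun x => u (g * x)%g) = m u
}.

Definition amenable : Prop := exists m : (G -> R) -> R, invariant_mean m.

End Amenability.

Section HilbertSchmidtStability.
Context (R : realType).

(* The trace below is a nonnegative real number, hence taking its real part
   loses nothing. *)
Definition dHS (n : nat) (A B : 'M[R[i]]_n) : R :=
  Num.sqrt (n%:R^-1 * complex.Re (\tr ((A - B)^t* *m (A - B)))).

Context (G : groupType).

(* Sequences of maps into U(1), U(2), ... are indexed by nat with a shift:
   the n-th map goes to U(n.+1). *)
Record asymptotic_hom (f : forall n : nat, G -> 'M[R[i]]_n.+1) : Prop :=
  AsymptoticHom {
    asym_unitary : forall n g, f n g \is unitarymx;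
    asym_mul : forall g h,
      (fun n => dHS (f n g *m f n h) (f n (g * h)%g)) @ \oo --> (0 : R)
  }.

(* A multiplicative map into a group preserves the unit. *)
Record unitary_hom (n : nat) (phi : G -> 'M[R[i]]_n) : Prop := UnitaryHom {
  hom_unitary : forall g, phi g \is unitarymx;
  hom_mul : forall g h, phi (g * h)%g = phi g *m phi h
}.

Definition HS_stable : Prop :=
  forall f : forall n : nat, G -> 'M[R[i]]_n.+1, asymptotic_hom f ->
  exists phi : forall n : nat, G -> 'M[R[i]]_n.+1,
    (forall n, unitary_hom (phi n)) /\
    (forall g, (fun n => dHS (f n g) (phi n g)) @ \oo --> (0 : R)).

End HilbertSchmidtStability.

(* The library requires measurable types to be pointed; the empty space carries
   no probability measure. *)
Definition borel (X : ptopologicalType) := g_sigma_algebraType (@open X).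

Section DensePeriodicMeasures.
Context (R : realType) (G : groupType) (X : ptopologicalType).
Context (act : G -> X -> X).

Definition metrizable : Prop := exists d : X -> X -> R,
  [/\ forall x y, (d x y == 0) = (x == y),
      forall x y, d x y = d y x,
      forall x y z, d x z <= d x y + d y z
    & forall (x : X) (A : set X), nbhs x A <->
        exists2 e : R, 0 < e & [set y | d x y < e] `<=` A].

Record topological_dynamical_system : Prop := TopologicalDynamicalSystem {
  tds_act1 : forall x, act 1%g x = x;
  tds_actM : forall g h x, act (g * h)%g x = act g (act h x);
  tds_continuous : forall g, continuous (act g);
  tds_compact : compact [set: X];
  tds_metrizable : metrizable
}.

Definition invariant (mu : probability (borel X) R) : Prop :=
  forall (g : G) (A : set (borel X)), measurable A ->
    mu (act g @^-1` A) = mu A.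

Definition support (mu : probability (borel X) R) : set X :=
  [set x | forall U : set X, open U -> U x -> (0 < mu U)%E].

Definition weak_star_limit (nu : nat -> probability (borel X) R)
    (mu : probability (borel X) R) : Prop :=
  forall f : X -> R, continuous f ->
    (fun k => \int[nu k]_(x in [set: borel X]) f x) @ \oo -->
    \int[mu]_(x in [set: borel X]) f x.

Definition has_dense_periodic_measures : Prop :=
  forall mu : probability (borel X) R, invariant mu ->
  exists nu : nat -> probability (borel X) R,
    (forall k, invariant (nu k) /\ finite_set (support (nu k))) /\
    weak_star_limit nu mu.

End DensePeriodicMeasures.

Section Subgroup.
Context (G : groupType) (N : groupClosed G).

Definition subgroup : Type := {x : G | x \in N}.

HB.instance Definition _ := SubChoice.on subgroup.

Fact subgroup_closed : group_closed (fun x : G => x \in N).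
Proof. by split; [exact: gpred1 | move=> x y; exact: gpredF]. Qed.

HB.instance Definition _ :=
  SubChoice_isSubGroup.Build G (fun x : G => x \in N) subgroup subgroup_closed.

Definition abelian_subgroup : Prop :=
  forall x y, x \in N -> y \in N -> (x * y = y * x)%g.

Definition normal_subgroup : Prop :=
  forall g x, x \in N -> (g^-1 * x * g)%g \in N.

Definition conj_subgroup (nN : normal_subgroup) (g : G) (x : subgroup)
  : subgroup := exist _ (g^-1 * sval x * g)%g (nN g (sval x) (svalP x)).

End Subgroup.

Section PontryaginDual.
Context (R : realType) (H : groupType).

Definition is_character (chi : H -> R[i]) : Prop :=
  (forall x, `|chi x| = 1) /\ (forall x y, chi (x * y)%g = chi x * chi y).

(* H is discrete: every homomorphism to the circle is continuous and the
   compact-open topology is the topology of pointwise convergence. *)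
Definition characters : set {ptws H -> R[i]^o} := [set chi | is_character chi].

Definition dual : Type := set_type characters.

Definition mk_dual (chi : H -> R[i]) (chiP : is_character chi) : dual :=
  exist _ (chi : {ptws H -> R[i]^o}) (mem_set (chiP : characters chi)).

HB.instance Definition _ := Topological.copy dual (set_type characters).

Fact trivial_characterP : is_character (fun=> 1).
Proof. by split=> *; rewrite ?normr1 ?mulr1. Qed.

HB.instance Definition _ :=
  isPointed.Build dual (mk_dual trivial_characterP).

End PontryaginDual.

Section DualAction.
Context (R : realType) (G : groupType) (N : groupClosed G).
Hypothesis nN : normal_subgroup N.

Fact dual_act_subproof (g : G) (chi : dual R (subgroup N)) :
  is_character (fun x => sval chi (conj_subgroup nN g x)).
Proof.
have [chi1 chiM] : is_character (sval chi) by exact: set_mem (svalP chi).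
split=> [x | x y]; first exact: chi1.
rewrite -chiM; congr (sval chi _); apply: val_inj.
by rewrite valM /= !mulgA mulgK.
Qed.

Definition dual_act (g : G) (chi : dual R (subgroup N)) : dual R (subgroup N) :=
  mk_dual (dual_act_subproof g chi).

End DualAction.

(* The next sections show that the dual of a subgroup of a countable group is
   compact and metrizable and that the dual action is continuous. *)

Fact min_triangle (R : realFieldType) (c a b t : R) :
  0 <= c -> 0 <= a -> 0 <= b -> t <= a + b ->
  Num.min c t <= Num.min c a + Num.min c b.
Proof.
move=> c0 a0 b0 tab; rewrite ge_min.
case: (leP c a) => ?; case: (leP c b) => ?; apply/orP; by [left; lra | right; lra].
Qed.

Section DualSpace.
Context (R : realType) (H : groupType).
Local Notation D := (dual R H).

Lemma cvg_dual (F : set_system D) (chi : D) : Filter F ->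
  F --> chi <->
  forall x, (fun psi : D => sval psi x : R[i]^o) @ F --> (sval chi x : R[i]^o).
Proof.
move=> FF; split=> [Fchi x|Fchi].
  have ev : {for chi, continuous (fun psi : D => sval psi x : R[i]^o)}.
    apply: (@continuous_comp D {ptws H -> R[i]^o} R[i]^o
             (fun psi : D => sval psi) (fun u => u x)).
      exact: initial_continuous.
    exact: (@proj_continuous H (fun=> R[i]^o) x).
  by apply: cvg_trans (cvg_app _ Fchi) _; exact: ev.
have cF : (fun psi : D => (sval psi : {ptws H -> R[i]^o})) @ F -->
          (sval chi : {ptws H -> R[i]^o}).
  apply/cvg_sup => x U [V [[W oW <-] Wchi] WU].
  apply: filterS WU _; apply: Fchi; exact: open_nbhs_nbhs.
move=> A [B [[U oU <-] Uchi] UA].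
apply: filterS UA _; apply: cF; exact: open_nbhs_nbhs.
Qed.

Lemma ev_continuous x : continuous (fun psi : D => sval psi x : R[i]^o).
Proof.
move=> chi; exact: ((@cvg_dual (nbhs chi) chi _).1 cvg_id).
Qed.

Lemma dual_inj (chi psi : D) : (forall x, sval chi x = sval psi x) -> chi = psi.
Proof. by move=> e; apply: val_inj; apply: funext. Qed.

Lemma character_norm (chi : D) x : `|sval chi x| = 1.
Proof. by have [] := set_mem (svalP chi). Qed.

Lemma dual_metrizable : countable [set: H] -> metrizable R D.
Proof.
move=> /countable_injP[e einj].
pose m (chi psi : D) x : R :=
  Num.min (e x).+1%:R^-1 (Normc.normc (sval chi x - sval psi x)).
have m_ge0 chi psi x : 0 <= m chi psi x.
  rewrite le_min invr_ge0 ler0n /=.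
  by rewrite -lecR; exact: (normr_ge0 (sval chi x - sval psi x)).
have m_le chi psi x : m chi psi x <= (e x).+1%:R^-1 by rewrite ge_min lexx.
have V_le1 n : n.+1%:R^-1 <= 1 :> R by rewrite invf_le1// ler1n.
pose S chi psi := range (m chi psi).
have Sub chi psi : has_ubound (S chi psi).
  by exists 1 => _ [x _ <-]; exact: le_trans (m_le _ _ _) (V_le1 _).
have Sn0 chi psi : S chi psi !=set0 by exists (m chi psi 1%g); exists 1%g.
pose d chi psi : R := sup (S chi psi).
have m_d chi psi x : m chi psi x <= d chi psi.
  by apply: ub_le_sup => //; exists x.
have d_le chi psi c : (forall x, m chi psi x <= c) -> d chi psi <= c.
  by move=> mc; apply: ge_sup => // _ [x _ <-].
have m0 chi psi x : m chi psi x <= 0 -> sval chi x = sval psi x.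
  rewrite ge_min leNgt invr_gt0 ltr0Sn /= -lecR => h.
  by apply/eqP; rewrite -subr_eq0 -normr_le0; exact: h.
have msym chi psi x : m chi psi x = m psi chi x.
  by rewrite /m -opprB normcN.
exists d; split.
- move=> chi psi; apply/eqP/eqP => [d0|->].
    by apply: dual_inj => x; apply: m0; rewrite -d0.
  apply/eqP; rewrite eq_le; apply/andP; split.
    by apply: d_le => x; rewrite ge_min subrr Normc.normc0 lexx orbT.
  exact: le_trans (m_ge0 psi psi 1%g) (m_d _ _ _).
- by move=> chi psi; congr sup; apply/seteqP; split=> _ [x _ <-]; exists x.
- move=> chi psi xi; apply: d_le => x.
  apply: le_trans (lerD (m_d chi psi x) (m_d psi xi x)).
  apply: min_triangle => //.
  - by rewrite -lecR; exact: (normr_ge0 (sval chi x - sval psi x)).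
  - by rewrite -lecR; exact: (normr_ge0 (sval psi x - sval xi x)).
  - by rewrite -(subrKA (sval psi x)); exact: le_normcD.
move=> chi A; split; last first.
  case=> r r0 rA; apply: (@filterS _ (nbhs chi)) rA _.
  have r20 : 0 < r / 2 by rewrite divr_gt0.
  have near_lt n : \forall psi \near chi, forall x, (e x < n)%N ->
      Normc.normc (sval chi x - sval psi x) < r / 2.
    elim: n => [|n IH]; first by apply: (@filterE _ (nbhs chi)) => psi x; rewrite ltn0.
    have [[x ex]|nx] := pselect (exists x, e x = n); last first.
      apply: (@filterS _ (nbhs chi)) IH => psi hpsi x; rewrite ltnS leq_eqVlt.
      by case/predU1P => [ex|/hpsi//]; case: nx; exists x.
    have r2C : 0 < (r / 2)%:C%C :> R[i] by rewrite ltcR.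
    have /cvgrPdist_lt/(_ _ r2C) := @ev_continuous x chi.
    apply: (@filterS2 _ (nbhs chi)) IH => psi IH hx y; rewrite ltnS leq_eqVlt => /orP[/eqP ey|].
      by rewrite (einj y x) ?inE// ?ex// -ltcR.
    exact: IH.
  have [n nr] : exists n : nat, n.+1%:R^-1 < r / 2.
    exists (Num.truncn (r / 2)^-1).
    by rewrite invf_plt ?posrE ?ltr0Sn// truncnS_gt.
  apply: (@filterS _ (nbhs chi)) (near_lt n) => psi h /=.
  apply: (@le_lt_trans _ _ (r / 2)); last by lra.
  apply: d_le => x; rewrite ge_min.
  have [/h/ltW ->|nx] := ltnP (e x) n; first by rewrite orbT.
  apply/orP; left; apply: le_trans (ltW nr).
  by rewrite lef_pV2 ?posrE ?ltr0Sn// ler_nat.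
move=> chiA.
pose F := filter_from [set r : R | 0 < r] (fun r => [set psi | d chi psi < r]).
have FF : Filter F.
  apply: filter_from_filter; first by exists 1 => /=.
  move=> r s /= r0 s0; exists (Num.min r s); first by rewrite /= lt_min r0.
  by move=> psi /=; rewrite lt_min => /andP.
suff /(_ A chiA) [r r0 rA] : F --> chi by exists r.
apply/cvg_dual => x; apply/cvgrPdist_lt => eps eps0.
have [r r0 er] : exists2 r : R, 0 < r & eps = r%:C%C.
  exists (complex.Re eps); move: eps0; rewrite ltcE /= => /andP[/eqP im0 re0] //.
  by case: eps im0 re0 => a b /= -> _.
exists (Num.min r (e x).+1%:R^-1) => /=.
  by rewrite lt_min r0 invr_gt0 ltr0Sn.
move=> psi /(le_lt_trans (m_d _ _ x)); rewrite lt_min => /andP[].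
rewrite /m !gt_min ltxx /= => + nV; rewrite er.
have -> : `|sval chi x - sval psi x| = (Normc.normc (sval chi x - sval psi x))%:C%C by [].
rewrite ltcR => /orP[|//] /(lt_trans nV).
by [].
Qed.

Lemma circle_compact : compact [set z : R[i]^o | `|z| = 1].
Proof.
pose sq : set (R * R) := `[-1, 1] `*` `[-1, 1].
have csq : compact sq by apply: compact_setX; exact: segment_compact.
pose h (p : R * R) : R[i]^o := (p.1 +i* p.2)%C.
have hc : continuous h.
  move=> p; apply/cvgrPdist_lt => e e0.
  have [r r0 er] : exists2 r : R, 0 < r & e = r%:C%C.
    exists (complex.Re e); move: e0; rewrite ltcE /= => /andP[/eqP im0 re0] //.
    by case: e im0 re0 => a b /= -> _.
  near=> q.
  have h1 : `|p.1 - q.1| < r / 2.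
    by near: q; exact: (@cvgr_dist_lt _ _ _ _ _ fst p.1 cvg_fst _ (divr_gt0 r0 (ltr0Sn _ 1))).
  have h2 : `|p.2 - q.2| < r / 2.
    by near: q; exact: (@cvgr_dist_lt _ _ _ _ _ snd p.2 cvg_snd _ (divr_gt0 r0 (ltr0Sn _ 1))).
  rewrite er normc_def ltcR /h /=.
  apply: (@le_lt_trans _ _ (`|p.1 - q.1| + `|p.2 - q.2|)); last by lra.
  rewrite -[leRHS]ger0_norm ?addr_ge0// -sqrtr_sqr ler_wsqrtr//.
  rewrite [leRHS]sqrrD !real_normK ?num_real// -addrA [X in _ <= _ + X]addrC lerD2l lerDl.
  by rewrite mulrn_wge0// mulr_ge0.
apply: (@subclosed_compact R[i]^o _ (h @` sq)).
- rewrite (_ : mkset _ = (fun z : R[i]^o => `|z| : R[i]^o) @^-1` [set 1]).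
    apply: preimage_closed; first by move=> z _; exact: (@norm_continuous _ R[i]^o).
    apply: accessible_closed_set1; apply: hausdorff_accessible.
    exact: (@norm_hausdorff _ R[i]^o).
  by [].
- by apply: continuous_compact => //; exact: continuous_subspaceT.
- move=> z /= z1; exists (complex.Re z, complex.Im z); last by case: z {z1}.
  have : complex.Re z ^+ 2 + complex.Im z ^+ 2 = 1.
    move: z1; rewrite normc_def => -[] z1.
    by rewrite -(sqr_sqrtr (addr_ge0 (sqr_ge0 _) (sqr_ge0 _))) z1 expr1n.
  by rewrite /sq /= !in_itv /=; split; apply/andP; split; nra.
Unshelve. all: by end_near.
Qed.

Lemma dual_compact : compact [set: D].
Proof.
rewrite compact_ultra => F FU _.
pose Fx x := (fun psi : D => sval psi x : R[i]^o) @ F.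
have Fcirc x : Fx x [set z : R[i]^o | `|z| = 1].
  apply: (@filterS _ F _ setT); last exact: filterT.
  by move=> psi _ /=; have [+ _] := set_mem (svalP psi); apply.
have FxP x : ProperFilter (Fx x) by exact: fmap_proper_filter.
have FxU x : UltraFilter (Fx x).
  split; first exact: FxP.
  move=> G GP FxG; apply/seteqP; split=> // A GA.
  have [//|FA] := in_ultra_setVsetC ((fun psi : D => sval psi x : R[i]^o) @^-1` A) FU.
  have /FxG GnA : Fx x (~` A) by exact: FA.
  by have /filter_ex [? []] : G (A `&` ~` A) by exact: filterI.
have Fcvg x : exists z : R[i]^o, `|z| = 1 /\ Fx x --> z.
  have := circle_compact; rewrite compact_ultra => /(_ (Fx x) (FxU x) (Fcirc x)) [].
  by move=> z [/= z1 Fz]; exists z.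
have [chi chiP] := choice Fcvg.
have chiC : is_character chi.
  split=> [x|x y]; first exact: (chiP x).1.
  apply: (@cvg_unique _ (@norm_hausdorff _ R[i]^o) (Fx (x * y)%g) (FxP _)).
  - exact: (chiP _).2.
  - have -> : Fx (x * y)%g =
        (fun psi : D => (sval psi x : R[i]^o) * (sval psi y : R[i]^o)) @ F.
      rewrite /Fx; congr (_ @ F); apply/funext => psi.
      by have [_ ->] := set_mem (svalP psi).
    by apply: cvgM; [exact: (chiP x).2 | exact: (chiP y).2].
exists (mk_dual chiC); split=> //; apply/cvg_dual => x.
exact: (chiP x).2.
Qed.

End DualSpace.

Section DualActionContinuous.
Context (R : realType) (G : groupType) (N : groupClosed G).
Hypothesis nN : normal_subgroup N.
Local Notation act := (@dual_act R G N nN).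

Lemma dual_act1 chi : act 1%g chi = chi.
Proof.
apply: dual_inj => x /=; congr (sval chi _); apply: val_inj.
by rewrite /= invg1 mul1g mulg1.
Qed.

Lemma dual_actM g h chi : act (g * h)%g chi = act g (act h chi).
Proof.
apply: dual_inj => x /=; congr (sval chi _); apply: val_inj.
by rewrite /= invgM !mulgA.
Qed.

Lemma dual_act_continuous g : continuous (act g).
Proof.
move=> chi; have FF : Filter (act g @ nbhs chi) by exact: fmap_filter.
apply/(@cvg_dual R (subgroup N) _ _ FF) => x.
exact: (@ev_continuous R (subgroup N) (conj_subgroup nN g x) chi).
Qed.

Lemma dual_act_tds : countable [set: G] -> topological_dynamical_system R act.
Proof.
move=> Gc; split.
- exact: dual_act1.
- exact: dual_actM.
- exact: dual_act_continuous.
- exact: dual_compact.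
- apply: dual_metrizable; have /countable_injP[e einj] := Gc.
  apply/countable_injP; exists (e \o val) => x y _ _ /einj exy.
  by apply: val_inj; apply: exy; rewrite inE.
Qed.

End DualActionContinuous.

(* Main.v *)
Require Import Defs.
From HB Require Import structures.
From mathcomp Require Import all_boot all_order all_algebra.
From mathcomp Require Import all_classical all_reals all_analysis.
From mathcomp Require Import measurable_realfun perm complex spectral ring lra.

Set Implicit Arguments.
Unset Strict Implicit.
Unset Printing Implicit Defensive.

Import Order.TTheory GRing.Theory Num.Theory.
Import numFieldNormedType.Exports.

Local Open Scope classical_set_scope.
Local Open Scope ring_scope.
Local Open Scope sesquilinear_scope.

(** Let X be the dual of N and mu an invariant probability measure on X.

The measure is first realized by matrices. Inducing a character chi from N to
G gives a monomial representation on the functions on G/N in which N acts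
diagonally, through the translates of chi (coset_cocycle, coset_cocycle_normal).
The space G/N carries finitely supported weights that are almost invariant
under any finite part of G: this is Reiter's condition, obtained from an
invariant mean by separation (hahn_banach, reiter, amenable_reiter). Take finitely many
characters distributed approximately like mu (quantization), induce each of
them, and compress to a finite set that follows the almost invariant weights
(weighted_sample): completing the resulting partial permutations to
permutations yields unitary matrices that are almost multiplicative
(monomial_almost_hom), while N still acts by exactly diagonal matrices. Since
mu is invariant, the characters on the diagonal are again distributed
approximately like mu (exists_matrix_model). Letting the precision improve
slowly with the dimension (slow_diagonal) produces an asymptotic homomorphism f.

Stability replaces f by homomorphisms phi. The matrices phi(x), for x in N,
commute, hence are diagonal in a common orthonormal basis
(exists_diagonalization), and the uniform distribution nu on the resulting
eigencharacters is finitely supported. It is invariant, because phi(g)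
permutes the joint eigenspaces of N (diagonalization_invariant).

It remains to compare nu with the distribution of the characters on the
diagonal of f. The squared moduli of the entries of the unitary change of
basis form a doubly stochastic matrix, that is, a coupling of the two
distributions; its transport cost for the squared distance of values at x in N
is exactly the square of the Hilbert-Schmidt distance of f(x) and phi(x), so it
tends to 0. As a continuous function on X is controlled, up to any error, by
the values at finitely many x (char_dist_modulus), both distributions have the
same weak-* limit mu (spectral_transport). *)

(** * Hahn-Banach theorem for sublinear functionals *)

Section Sublinear.
Context (R : realType) (V : lmodType R).
Implicit Types (p q : V -> R) (u v : V).

Definition sublinear q : Prop :=
  (forall u v, q (u + v) <= q u + q v) /\
  (forall t v, 0 < t -> q (t *: v) = t * q v).

Lemma sublinear0 q : sublinear q -> q 0 = 0.
Proof. by case=> _ /(_ 2 0 (ltr0Sn _ 1)); rewrite scaler0; lra. Qed.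

Lemma sublinearN q v : sublinear q -> - q (- v) <= q v.
Proof.
move=> qs; have [qD _] := qs; have := qD v (- v).
by rewrite subrr sublinear0//; lra.
Qed.

(** Infima of families of sublinear functions occur three times: for the lower
bound of a chain, for the directional decrease that makes a minimal function
additive, and for the separation that yields almost invariant weights. The
lower bound L keeps the infimum finite. *)
Lemma sublinear_inf (I : Type) (A : set I) (F : I -> V -> R) (L : V -> R) :
  A !=set0 -> (forall i v, A i -> L v <= F i v) ->
  (forall i j u v, A i -> A j ->
    exists2 k, A k & F k (u + v) <= F i u + F j v) ->
  (forall i t v, A i -> 0 < t -> exists2 k, A k & F k (t *: v) <= t * F i v) ->
  exists q, [/\ sublinear q, forall i v, A i -> q v <= F i v
    & forall x v, (forall i, A i -> x <= F i v) -> x <= q v].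
Proof.
move=> [i0 Ai0] LF FD FZ.
pose S v := [set F i v | i in A].
have S0 v : S v !=set0 by exists (F i0 v); exists i0.
have Slb v : has_lbound (S v) by exists (L v) => _ [i Ai <-]; exact: LF.
have infF i v : A i -> inf (S v) <= F i v.
  by move=> Ai; apply: ge_inf => //; exists i.
have le_infP x v : (forall i, A i -> x <= F i v) -> x <= inf (S v).
  by move=> xF; apply: lb_le_inf => // _ [i Ai <-]; exact: xF.
(* The reverse inequality follows by applying this one to t^-1. *)
have infZ t v : 0 < t -> inf (S (t *: v)) <= t * inf (S v).
  move=> t0; rewrite -ler_pdivrMl//; apply: le_infP => i Ai.
  have [k Ak] := FZ i t v Ai t0; rewrite ler_pdivrMl//.
  by move=> h; apply: le_trans h; exact: infF.
exists (fun v => inf (S v)); split=> //; split=> [u v|t v t0].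
  rewrite -lerBlDr; apply: (le_infP) => i Ai.
  rewrite lerBlDr -lerBlDl; apply: le_infP => j Aj.
  have [k Ak Fk] := FD i j u v Ai Aj.
  by rewrite lerBlDl; exact: le_trans (infF k _ Ak) Fk.
apply/eqP; rewrite eq_le infZ//=.
have := infZ t^-1 (t *: v); rewrite invr_gt0 scalerA mulVf ?gt_eqF// scale1r.
by move=> /(_ t0); rewrite ler_pdivlMl.
Qed.

(** Zorn's lemma applies because the pointwise infimum of a chain is sublinear;
all members lie above v |-> - q (- v), so the infimum is finite. *)
Lemma exists_minimal_sublinear q : sublinear q ->
  exists p, [/\ sublinear p, forall v, p v <= q v
    & forall p', sublinear p' -> (forall v, p' v <= p v) -> p' = p].
Proof.
move=> qs.
pose T := {p : V -> R | sublinear p /\ forall v, p v <= q v}.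
pose ge (p p' : T) := `[< forall v, sval p' v <= sval p v >].
have [|||chain|p pmin] := @Zorn T ge.
- by move=> p; apply/asboolP => v.
- move=> p1 p2 p3 /asboolP h12 /asboolP h23; apply/asboolP => v.
  exact: le_trans (h23 v) (h12 v).
- move=> [p1 P1] [p2 P2] /asboolP h12 /asboolP h21; apply: eq_exist => /=.
  by apply/funext => v; apply/eqP; rewrite eq_le h12 h21.
- move=> tot; have [[p0 Ap0]|A0] := pselect (chain !=set0); last first.
    by exists (exist _ q (conj qs (fun=> lexx _))) => s As; case: A0; exists s.
  have [||i j u v Ai Aj|i t v Ai t0|p [ps pF pI]] := @sublinear_inf T chain
    (fun p : T => sval p) (fun v => - q (- v)).
  + by exists p0.
  + move=> p v Ap; apply: le_trans (sublinearN v (svalP p).1).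
    by rewrite lerN2; exact: (svalP p).2.
  + have [/asboolP ij|/asboolP ji] := tot i j Ai Aj.
      by exists j => //; rewrite (le_trans ((svalP j).1.1 u v))// lerD2r.
    by exists i => //; rewrite (le_trans ((svalP i).1.1 u v))// lerD2l.
  + by exists i => //; rewrite (svalP i).1.2.
  have pq v : p v <= q v by apply: le_trans (pF p0 v Ap0) ((svalP p0).2 v).
  exists (exist _ p (conj ps pq)) => s As; apply/asboolP => v; exact: pF.
exists (sval p); split; [exact: (svalP p).1|exact: (svalP p).2|].
move=> p' p's p'p.
have p'q v : p' v <= q v by apply: le_trans (p'p v) ((svalP p).2 v).
by have /(congr1 sval) := pmin (exist _ p' (conj p's p'q)) (introT (asboolP _) p'p).
Qed.

(** A minimal sublinear function p is linear: for fixed y, the infimum over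
t >= 0 of p (x + t y) - t p y is sublinear and lies below p, hence equals p, and
t = 1 gives p x + p y <= p (x + y). *)
Lemma hahn_banach q : sublinear q ->
  exists L : V -> R, [/\ forall u v, L (u + v) = L u + L v,
    forall t v, L (t *: v) = t * L v & forall v, L v <= q v].
Proof.
move=> /exists_minimal_sublinear[p [ps pq pmin]].
have [pD pZ] := ps.
have pDge x y : p x + p y <= p (x + y).
  have [||s t u v s0 t0|s t v s0 t0|q' [q's q'F q'I]] := @sublinear_inf R
    [set t | 0 <= t] (fun t x => p (x + t *: y) - t * p y) (fun x => - p (- x)).
  - by exists 0 => /=.
  - move=> t x' /=; rewrite le_eqVlt => /predU1P[<-|t0].
      by rewrite scale0r mul0r addr0 subr0; exact: sublinearN.
    rewrite -pZ// lerBrDl; have := pD (x' + t *: y) (- x').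
    by rewrite addrAC subrr add0r; lra.
  - exists (s + t); first exact: addr_ge0.
    rewrite scalerDl mulrDl; have := pD (u + s *: y) (v + t *: y).
    by rewrite addrACA; lra.
  - exists (t * s); first by rewrite /= mulr_ge0// ltW.
    by rewrite -scalerA -scalerDr pZ// mulrBr mulrA.
  have q'p : q' = p.
    apply: pmin => // v; apply: le_trans (q'F 0 v (lexx _)) _.
    by rewrite scale0r mul0r addr0 subr0.
  by have := q'F 1 x ler01; rewrite q'p scale1r mul1r lerBrDr.
have LD x y : p (x + y) = p x + p y by apply/eqP; rewrite eq_le pD pDge.
have LN x : p (- x) = - p x.
  by apply/eqP; rewrite -addr_eq0 addrC -LD subrr sublinear0.
exists p; split=> // t v.
have [t0|t0|->] := ltgtP t 0; last by rewrite scale0r mul0r sublinear0.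
- by have := pZ (- t) v; rewrite oppr_gt0 scaleNr LN mulNr => /(_ t0)/oppr_inj.
- exact: pZ.
Qed.

End Sublinear.

(** * Reiter's condition *)

Section FinitelySupported.
Context (R : realType).
Implicit Types (v w : {poly R}).

(** Polynomials serve as finitely supported sequences, with coefficients as
values. *)
Definition l1norm v : R := \sum_(k < size v) `|v`_k|.

Lemma l1normE v n : (size v <= n)%N -> l1norm v = \sum_(k < n) `|v`_k|.
Proof.
move=> vn; rewrite /l1norm [RHS](bigID (fun k : 'I_n => (k < size v)%N))/=.
rewrite [X in _ = _ + X]big1 ?addr0; last first.
  by move=> k; rewrite -leqNgt => /(nth_default 0) ->; rewrite normr0.
by rewrite (big_ord_widen n (fun k => `|v`_k|)).
Qed.

Lemma l1norm_ge0 v : 0 <= l1norm v.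
Proof. exact: sumr_ge0. Qed.

Lemma l1normD v w : l1norm (v + w) <= l1norm v + l1norm w.
Proof.
pose n := maxn (size v) (size w).
rewrite (@l1normE v n) ?leq_maxl// (@l1normE w n) ?leq_maxr//.
rewrite (@l1normE (v + w) n) ?size_polyD// -big_split/=.
by apply: ler_sum => k _; rewrite coefD ler_normD.
Qed.

Lemma l1normZ t v : l1norm (t *: v) = `|t| * l1norm v.
Proof.
rewrite (@l1normE _ (size v)) ?size_scale_leq// mulr_sumr.
by apply: eq_bigr => k _; rewrite coefZ normrM.
Qed.

Lemma l1norm0 : l1norm 0 = 0.
Proof. by rewrite /l1norm size_poly0 big_ord0. Qed.

Lemma l1normXn k : l1norm 'X^k = 1.
Proof.
rewrite (@l1normE _ k.+1) ?size_polyXn// big_ord_recr/= coefXn eqxx normr1.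
by rewrite big1 ?add0r// => i _; rewrite coefXn ltn_eqF// normr0.
Qed.

Lemma sum_coef_le_l1norm v (s : seq nat) : uniq s ->
  \sum_(k <- s) `|v`_k| <= l1norm v.
Proof.
move=> us; rewrite (bigID (fun k => k < size v)%N)/= [X in _ + X]big1 ?addr0.
  rewrite -big_filter /l1norm -(big_mkord xpredT (fun k => `|v`_k|)).
  rewrite (perm_big [seq k <- iota 0 (size v) | k \in s]); last first.
    apply: uniq_perm; rewrite ?filter_uniq ?iota_uniq// => k.
    by rewrite !mem_filter mem_iota andbC.
  by rewrite big_filter /index_iota subn0 [leRHS](bigID (mem s))/= lerDl sumr_ge0.
by move=> k; rewrite -leqNgt => /(nth_default 0) ->; rewrite normr0.
Qed.

End FinitelySupported.

Section Reiter.
Context (R : realType) (G : groupType) (Q : choiceType) (act : G -> Q -> Q).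
Hypothesis act_inj : forall g, injective (act g).
Hypothesis Q_countable : countable [set: Q].

(** If no weights p were almost invariant, the displacements D p, with components
the images of p by g i minus p, would stay at l1-distance eps from 0. A functional
separating them from 0 is given by bounded functions u i on Q, and evaluating
it at point masses contradicts the hypothesis. The functional is obtained
below the sublinear function
  v |-> inf over weights a >= 0 of l1norm (v + D a) - eps * (mass of a).
The pairs (i, q) are encoded as natural numbers, so that the displacements are
polynomials. *)
Lemma reiter n (g : 'I_n -> G) (eps : R) : 0 < eps ->
  (forall u : 'I_n -> Q -> R, (forall i q, `|u i q| <= 1) ->
    exists q, \sum_(i < n) (u i (act (g i) q) - u i q) < eps) ->
  exists (qs : seq Q) (p : Q -> R), [/\ uniq qs, forall q, 0 <= p q,
    forall q, q \notin qs -> p q = 0, \sum_(q <- qs) p q = 1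
    & forall i, \sum_(q <- qs) `|p q - p (act (g i) q)| <= eps].
Proof.
move=> eps0 nsep.
have [c cinj] := countable_injP _ Q_countable.
pose e (i : 'I_n) q := pickle (i : nat, c q).
have eE i q j q' : (e i q == e j q') = (i == j) && (q == q').
  apply/eqP/andP => [/(pcan_inj pickleK)[/ord_inj -> cq]|[/eqP-> /eqP->]//].
  by split=> //; apply/eqP/cinj; rewrite ?inE.
(* D1 q is the displacement of the point mass at q; a list of pairs
   (coefficient, point) describes a weight. *)
pose D1 q : {poly R} := \sum_(i < n) ('X^(e i (act (g i) q)) - 'X^(e i q)).
pose D (a : seq (R * Q)) := \sum_(x <- a) x.1 *: D1 x.2.
pose wt (a : seq (R * Q)) := \sum_(x <- a) x.1.
pose A := [set a : seq (R * Q) | all (fun x => 0 <= x.1) a].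
have [a Aa aeps] : exists2 a, A a & l1norm (D a) < eps * wt a.
  apply: contrapT => /forall2NP nA.
  have {}nA a : A a -> eps * wt a <= l1norm (D a).
    by move=> Aa; have [//|/negP] := nA a; rewrite -leNgt.
  have scaleE t (a : seq (R * Q)) (b := [seq (t * x.1, x.2) | x <- a]) :
      D b = t *: D a /\ wt b = t * wt a.
    rewrite /D /wt /b !big_map /= mulr_sumr scaler_sumr; split=> //.
    by apply: eq_bigr => x _; rewrite scalerA.
  have [||a b u v Aa Ab|a t v Aa t0|q [qs qF _]] := @sublinear_inf R {poly R}
    _ A (fun a v => l1norm (v + D a) - eps * wt a) (fun v => - l1norm v).
  - by exists [::].
  - move=> a v /nA h; have := l1normD (- v) (v + D a).
    by rewrite addKr -[- v]scaleN1r l1normZ normrN1; lra.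
  - exists (a ++ b); first by rewrite /A/= all_cat Aa Ab.
    rewrite /D /wt !big_cat /= -/(D a) -/(D b) -/(wt a) -/(wt b) mulrDr addrACA.
    by have := l1normD (u + D a) (v + D b); lra.
  - exists [seq (t * x.1, x.2) | x <- a].
      by rewrite /A/= all_map; apply: sub_all Aa => x /=; exact: mulr_ge0 (ltW t0).
    have [-> ->] := scaleE t a; rewrite -scalerDr l1normZ ger0_norm ?(ltW t0)//.
    by rewrite mulrBr mulrCA.
  have [L [LD LZ Lq]] := hahn_banach qs.
  have LN v : L (- v) = - L v by rewrite -scaleN1r LZ mulN1r.
  have L0 : L 0 = 0 by rewrite -(scale0r 0) LZ mul0r.
  have L_le v : L v <= l1norm v.
    apply: le_trans (Lq v) _; have := qF [::] v isT.
    by rewrite /D /wt !big_nil addr0 mulr0 subr0.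
  have [|x] := nsep (fun i x => L 'X^(e i x)).
    move=> i x; have := L_le 'X^(e i x); have := L_le (- 'X^(e i x)).
    rewrite LN -(scaleN1r 'X^_) l1normZ normrN1 l1normXn mulr1 => h1 h2.
    by rewrite ler_norml h2 lerNl h1.
  have -> : \sum_(i < n) (L 'X^(e i (act (g i) x)) - L 'X^(e i x)) = L (D1 x).
    rewrite /D1 (big_morph L LD L0).
    by apply: eq_bigr => i _; rewrite LD LN.
  apply/negP; rewrite -leNgt -[L _]opprK -LN lerNr.
  apply: le_trans (Lq _) _; have := qF [:: (1, x)] (- D1 x).
  rewrite /A/= ler01 => /(_ isT) /le_trans; apply.
  by rewrite /D /wt !big_seq1 /= scale1r addNr l1norm0 mulr1 add0r.
have wt0 : 0 < wt a.
  by have := le_lt_trans (l1norm_ge0 _) aeps; rewrite pmulr_rgt0.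
(* The list a may repeat points; P collects the coefficients at each point. *)
pose P q := \sum_(x <- a | x.2 == q) x.1.
have P0 q : 0 <= P q.
  by rewrite /P big_seq_cond sumr_ge0// => x /andP[xa _]; exact: (allP Aa).
pose qs := undup [seq x.2 | x <- a].
exists qs, (fun q => P q / wt a); split.
- exact: undup_uniq.
- by move=> q; rewrite divr_ge0// ltW.
- move=> q; rewrite mem_undup => qa; rewrite /P big_seq_cond big_pred0 ?mul0r//.
  by move=> x; apply/negP => /andP[xa /eqP xq]; case/mapP: qa; exists x.
- rewrite -mulr_suml; have -> : \sum_(q <- qs) P q = wt a; last first.
    by rewrite divff// gt_eqF.
  rewrite /P (exchange_big_dep xpredT)//= /wt big_seq [RHS]big_seq.
  apply: eq_bigr => x xa; rewrite big_mkcond (bigD1_seq x.2) ?undup_uniq//=.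
    by rewrite eqxx big1 ?addr0// => q; rewrite eq_sym => /negbTE ->.
  by rewrite mem_undup map_f.
move=> i; have coefDa q : (D a)`_(e i (act (g i) q)) = P q - P (act (g i) q).
  rewrite /D coef_sum /P [X in X - _]big_mkcond [X in _ - X]big_mkcond -sumrB.
  apply: eq_bigr => x _; rewrite coefZ /D1 coef_sum (bigD1 i)//= big1 => [|j ji].
    rewrite addr0 coefB !coefXn !eE eqxx/= (inj_eq (@act_inj _)) -!(eq_sym x.2).
    by rewrite mulrBr !mulr_natr; do 2!case: eqP => _.
  by rewrite coefB !coefXn !eE eq_sym (negbTE ji) subr0.
have := @sum_coef_le_l1norm R (D a) [seq e i (act (g i) q) | q <- qs].
rewrite map_inj_uniq ?undup_uniq => [/(_ isT)|q q' /eqP]; last first.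
  by rewrite eE eqxx => /eqP/act_inj.
rewrite big_map => h.
have -> : \sum_(q <- qs) `|P q / wt a - P (act (g i) q) / wt a| =
          (\sum_(q <- qs) `|(D a)`_(e i (act (g i) q))|) / wt a.
  rewrite mulr_suml; apply: eq_bigr => q _.
  by rewrite coefDa -mulrBl normrM [`|_^-1|]ger0_norm// invr_ge0 ltW.
by rewrite ler_pdivrMr// (le_trans h)// ltW.
Qed.

End Reiter.

(** * The coset space and its cocycle *)

Section CosetSpace.
Context (G : groupType) (N : groupClosed G).
Implicit Types (g h y : G).

(** The points of G/N are the canonical representatives of the left cosets.
This makes a section of G -> G/N available, which the cocycle of an induced
representation requires. *)
Definition coset_repr g : G := choose (fun y => (g^-1 * y)%g \in N) g.

Lemma coset_repr_mem g : (g^-1 * coset_repr g)%g \in N.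
Proof.
have Ng : (fun y => (g^-1 * y)%g \in N) g by rewrite mulVg gpred1.
exact: (@chooseP _ (fun y => (g^-1 * y)%g \in N) g Ng).
Qed.

Lemma eq_coset_repr g h : (g^-1 * h)%g \in N -> coset_repr g = coset_repr h.
Proof.
move=> gh; have ghE y : ((g^-1 * y)%g \in N) = ((h^-1 * y)%g \in N).
  by rewrite -[RHS](gpredMl _ gh) -mulgA mulVKg.
rewrite /coset_repr (eq_choose ghE); apply: choose_id; last by rewrite mulVg gpred1.
by rewrite -ghE mulVg gpred1.
Qed.

Definition coset : Type := {t : G | coset_repr t == t}.
HB.instance Definition _ := SubChoice.on coset.

Fact coset_of_subproof g : coset_repr (coset_repr g) == coset_repr g.
Proof. by apply/eqP/esym/eq_coset_repr/coset_repr_mem. Qed.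

Definition coset_of g : coset := exist _ (coset_repr g) (coset_of_subproof g).

Lemma eq_coset_of g h : (g^-1 * h)%g \in N -> coset_of g = coset_of h.
Proof. by move=> gh; apply: val_inj; exact: eq_coset_repr. Qed.

Lemma coset_of_val (q : coset) : coset_of (val q) = q.
Proof. by apply: val_inj; exact/eqP/(valP q). Qed.

Definition coset_act g (q : coset) : coset := coset_of (g * val q)%g.

Lemma coset_act_of g h : coset_act g (coset_of h) = coset_of (g * h)%g.
Proof.
apply/esym/eq_coset_of; rewrite invgM mulgA -[(_ * g)%g]mulgA mulVg mulg1.
exact: coset_repr_mem.
Qed.

Lemma coset_actM g h q : coset_act (g * h)%g q = coset_act g (coset_act h q).
Proof. by rewrite -{1}(coset_of_val q) !coset_act_of mulgA. Qed.

Lemma coset_act1 q : coset_act 1%g q = q.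
Proof. by rewrite /coset_act mul1g coset_of_val. Qed.

Lemma coset_act_inj g : injective (coset_act g).
Proof.
by apply: (can_inj (g := coset_act g^-1%g)) => q; rewrite -coset_actM mulVg coset_act1.
Qed.

Fact coset_cocycle_subproof g (q : coset) :
  ((val (coset_act g q))^-1 * (g * val q))%g \in N.
Proof. by rewrite -gpredV invgM invgK; exact: coset_repr_mem. Qed.

(** The element n of N such that g r = r' n, where r represents q and r'
represents the coset g q. *)
Definition coset_cocycle g (q : coset) : subgroup N :=
  exist (fun x => x \in N) _ (coset_cocycle_subproof g q).

Lemma coset_cocycleM g h q : coset_cocycle (g * h)%g q =
  (coset_cocycle g (coset_act h q) * coset_cocycle h q)%g.
Proof.
apply: val_inj; rewrite valM.
change ((val (coset_act (g * h) q))^-1 * (g * h * val q) =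
  ((val (coset_act g (coset_act h q)))^-1 * (g * val (coset_act h q))) *
  ((val (coset_act h q))^-1 * (h * val q)))%g.
by rewrite coset_actM -!mulgA mulVKg.
Qed.

Section Normal.
Hypothesis nN : normal_subgroup N.

Lemma coset_act_normal (x : subgroup N) q : coset_act (val x) q = q.
Proof.
rewrite -[RHS]coset_of_val; apply/esym/eq_coset_of.
by rewrite mulgA; exact/nN/(valP x).
Qed.

(** Elements of N fix all cosets and act on the line over q of an induced
representation through a conjugate of the inducing character; this is where the
dual action enters. *)
Lemma coset_cocycle_normal (x : subgroup N) q :
  coset_cocycle (val x) q = conj_subgroup nN (val q) x.
Proof.
apply: val_inj.
change ((val (coset_act (val x) q))^-1 * (val x * val q) =
  (val q)^-1 * val x * val q)%g.
by rewrite coset_act_normal mulgA.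
Qed.

End Normal.

End CosetSpace.

(** * Almost invariant weights on the coset space *)

Section AmenableCosets.
Context (R : realType) (G : groupType) (N : groupClosed G).

Lemma bounded_fun_le (T : Type) (u : T -> R) (M : R) :
  (forall x, `|u x| <= M) -> bounded_fun u.
Proof.
move=> uM; exists M; split; first exact: num_real.
by move=> K /ltW MK x _; exact: le_trans (uM x) MK.
Qed.

Lemma mean_sum (m : (G -> R) -> R) n (f : 'I_n -> G -> R) (M : R) :
  invariant_mean m -> (forall i x, `|f i x| <= M) ->
  m (fun x => \sum_(i < n) f i x) = \sum_(i < n) m (f i).
Proof.
move=> mm; elim: n f => [|n IH] f fM.
  rewrite big_ord0; have b0 : bounded_fun (fun _ : G => 0 : R).
    by apply: (@bounded_fun_le _ _ 0) => x; rewrite normr0.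
  have := mean_linear mm (- 1) b0 b0.
  have -> : (fun x : G => -1 * 0 + 0 : R) = (fun=> 0).
    by apply/funext => x; rewrite mulr0 addr0.
  have -> : (fun x => \sum_(i < 0) f i x) = (fun=> 0).
    by apply/funext => x; rewrite big_ord0.
  by move=> h; lra.
rewrite big_ord_recl -IH => [|//].
have b1 : bounded_fun (f ord0) by exact: bounded_fun_le (fM ord0).
have b2 : bounded_fun (fun x => \sum_(i < n) f (lift ord0 i) x).
  apply: (@bounded_fun_le _ _ (\sum_(i < n) M)) => x.
  by rewrite (le_trans (ler_norm_sum _ _ _))// ler_sum.
have := mean_linear mm 1 b1 b2; rewrite mul1r => <-.
by congr m; apply/funext => x; rewrite big_ord_recl mul1r.
Qed.

(** An invariant mean on G, applied to functions that factor through G/N, gives a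
zero average to all sums of u (g q) - u q, so such a sum cannot be bounded
below by eps > 0. *)
Lemma amenable_reiter : countable [set: G] -> amenable R G ->
  forall n (g : 'I_n -> G) (eps : R), 0 < eps ->
  exists (qs : seq (coset N)) (p : coset N -> R),
    [/\ uniq qs, forall q, 0 <= p q, forall q, q \notin qs -> p q = 0,
        \sum_(q <- qs) p q = 1
      & forall i, \sum_(q <- qs) `|p q - p (coset_act (g i) q)| <= eps].
Proof.
move=> Gc [m mm] n g eps eps0; apply: reiter => //.
- exact: coset_act_inj.
- have /countable_injP[c cinj] := Gc; apply/countable_injP.
  exists (c \o val) => x y _ _ /cinj xy.
  by apply: val_inj; apply: xy; rewrite inE.
move=> u u1; apply: contrapT => /forallNP nu.
pose v i y : R := u i (coset_of N y).
have vb i : bounded_fun (v i) by apply: bounded_fun_le (fun y => u1 i _).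
have vgb i : bounded_fun (fun y => v i (g i * y)%g).
  by apply: bounded_fun_le (fun y => u1 i _).
pose w i y := v i (g i * y)%g - v i y.
have mw i : m (w i) = 0.
  have := mean_linear mm (- 1) (vb i) (vgb i).
  rewrite (mean_translate mm)// mulN1r addNr => <-.
  by congr m; apply/funext => y; rewrite mulN1r addrC.
have w2 i y : `|w i y| <= 2.
  by rewrite (le_trans (ler_normB _ _))// -[leRHS]/(1 + 1) lerD// u1.
have wb : bounded_fun (fun y => \sum_(i < n) w i y).
  apply: (@bounded_fun_le _ _ (\sum_(i < n) 2)) => y.
  by rewrite (le_trans (ler_norm_sum _ _ _))// ler_sum.
have cb : bounded_fun (fun _ : G => 1 : R).
  by apply: (@bounded_fun_le _ _ 1) => x; rewrite normr1.
have wcb : bounded_fun (fun y => (- eps) * 1 + \sum_(i < n) w i y).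
  apply: (@bounded_fun_le _ _ (eps + \sum_(i < n) 2)) => y.
  rewrite (le_trans (ler_normD _ _))// mulr1 normrN gtr0_norm// lerD2l.
  by rewrite (le_trans (ler_norm_sum _ _ _))// ler_sum.
have := mean_ge0 mm wcb; rewrite (mean_linear mm)// (mean1 mm) (mean_sum mm w2).
rewrite (eq_bigr (fun=> 0)) => [|i _]; last exact: mw.
rewrite big1// addr0 mulr1 oppr_ge0 leNgt eps0 => /(_ _)/notF[] // y.
rewrite addrC subr_ge0 leNgt; apply/negP => h; apply: (nu (coset_of N y)).
rewrite (le_lt_trans _ h)//; apply: ler_sum => i _.
by rewrite coset_act_of.
Qed.

End AmenableCosets.

(** * Monomial matrices *)

Section SquaredModulus.
Context (R : realType).
Implicit Types (z : R[i]).

Definition sqmod z : R := complex.Re z ^+ 2 + complex.Im z ^+ 2.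

Lemma sqmod_ge0 z : 0 <= sqmod z.
Proof. by rewrite addr_ge0// sqr_ge0. Qed.

Lemma sqmod0 : sqmod 0 = 0.
Proof. by rewrite /sqmod /= expr0n addr0. Qed.

Lemma sqmodM z1 z2 : sqmod (z1 * z2) = sqmod z1 * sqmod z2.
Proof. by case: z1 z2 => [a b] [c d]; rewrite /sqmod /=; ring. Qed.

Lemma sqmodB z1 z2 : sqmod (z1 - z2) = sqmod (z2 - z1).
Proof. by case: z1 z2 => [a b] [c d]; rewrite /sqmod /=; ring. Qed.

Lemma sqmodD_le z1 z2 : sqmod (z1 + z2) <= 2 * (sqmod z1 + sqmod z2).
Proof.
case: z1 z2 => [a b] [c d]; rewrite /sqmod /=.
by have := sqr_ge0 (a - c); have := sqr_ge0 (b - d); nra.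
Qed.

Lemma conjC_sqmod z : z^* * z = (sqmod z)%:C%C.
Proof.
case: z => a b; rewrite /sqmod /=; apply/eqP; rewrite eq_complex /=.
by apply/andP; split; apply/eqP; ring.
Qed.

Lemma normc_sqmod z : Normc.normc z ^+ 2 = sqmod z.
Proof. by case: z => a b; rewrite /= sqr_sqrtr// addr_ge0// sqr_ge0. Qed.

Lemma norm1_sqmod z : `|z| = 1 -> sqmod z = 1.
Proof. by rewrite normc_def -normc_sqmod => -[]; case: z => a b /= ->; rewrite expr1n. Qed.

Lemma dHS_sqr n (A B : 'M[R[i]]_n) :
  dHS A B ^+ 2 = n%:R^-1 * \sum_j \sum_i sqmod (A i j - B i j).
Proof.
rewrite /dHS; set M := A - B.
have -> : complex.Re (\tr (M^t* *m M)) = \sum_j \sum_i sqmod (A i j - B i j).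
  rewrite /mxtrace raddf_sum; apply: eq_bigr => j _.
  rewrite mxE raddf_sum; apply: eq_bigr => i _.
  by rewrite !mxE conjC_sqmod.
rewrite sqr_sqrtr// mulr_ge0// ?invr_ge0// sumr_ge0// => j _.
by rewrite sumr_ge0// => i _; exact: sqmod_ge0.
Qed.

Lemma dHS_ge0 n (A B : 'M[R[i]]_n) : 0 <= dHS A B.
Proof. exact: sqrtr_ge0. Qed.

End SquaredModulus.

Section Monomial.
Context (R : realType) (n : nat).
Implicit Types (s t : {perm 'I_n}) (c d : 'I_n -> R[i]).

Definition monomialmx s c : 'M[R[i]]_n := \matrix_(i, j) (c j *+ (i == s j)).

Lemma monomialmx_mul s t c d :
  monomialmx s c *m monomialmx t d =
  monomialmx (t * s)%g (fun j => c (t j) * d j).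
Proof.
apply/matrixP => i j; rewrite !mxE (bigD1 (t j))//= big1 => [|k kj].
  by rewrite !mxE eqxx addr0 mulr1n mulrnAl permM.
by rewrite !mxE (negbTE kj) mulr0.
Qed.

Lemma monomialmx_unitary s c : (forall j, `|c j| = 1) ->
  monomialmx s c \is unitarymx.
Proof.
move=> c1; apply/unitarymxP/matrixP => i k; rewrite !mxE.
rewrite (bigD1 (s^-1 i)%g)//= big1 ?addr0 => [|j ji].
  rewrite !mxE permKV eqxx mulr1n [k == _]eq_sym.
  case: eqP => _; last by rewrite conjC0 mulr0.
  by rewrite mulr1n mulrC conjC_sqmod norm1_sqmod.
rewrite !mxE; have /negbTE -> : i != s j; last by rewrite mul0r.
by apply: contra ji => /eqP ->; rewrite permK.
Qed.

Lemma monomialmx1 c : monomialmx 1%g c = diag_mx (\row_j c j).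
Proof. by apply/matrixP => i j; rewrite !mxE perm1; case: eqVneq => // ->. Qed.

(** Columns on which both matrices agree contribute 0, and the difference of two
unit vectors has squared norm at most 4. *)
Lemma dHS_monomialmx s t c d : (forall j, `|c j| = 1) -> (forall j, `|d j| = 1) ->
  dHS (monomialmx s c) (monomialmx t d) ^+ 2 <=
  n%:R^-1 * (4 * #|[set j | ~~ ((s j == t j) && (c j == d j))]%SET|%:R).
Proof.
move=> c1 d1; rewrite dHS_sqr ler_wpM2l ?invr_ge0//.
rewrite -sum1_card natr_sum mulr_sumr [leRHS]big_mkcond/=.
apply: ler_sum => j _; rewrite inE mulr1.
have [/andP[/eqP st /eqP cd]|_] := boolP (_ && _).
  by rewrite big1// => i _; rewrite !mxE st cd subrr sqmod0.
have cE (u : {perm 'I_n}) (e : 'I_n -> R[i]) : `|e j| = 1 ->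
    \sum_i sqmod (e j *+ (i == u j)) = 1.
  move=> e1; rewrite (bigD1 (u j))//= big1 ?eqxx ?addr0 ?norm1_sqmod//.
  by move=> i /negbTE ->; rewrite mulr0n sqmod0.
have -> : 4 = 2 * (\sum_i sqmod (c j *+ (i == s j)) +
                   \sum_i sqmod (d j *+ (i == t j))) :> R.
  by rewrite !cE//; lra.
rewrite -big_split mulr_sumr/=; apply: ler_sum => i _.
have sN z : sqmod (- z) = sqmod z :> R by rewrite -sub0r sqmodB subr0.
by rewrite !mxE -(sN (d j *+ _)); exact: sqmodD_le.
Qed.

End Monomial.

(** A partial injection of a finite set misses as many points of the target as
of the source, so it can be extended one point at a time. *)
Lemma extend_partial_perm (I : finType) (A : {set I}) (h : I -> I) :
  {in A &, injective h} -> exists s : {perm I}, {in A, s =1 h}.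
Proof.
have [k] := ubnP #|~: A|; elim: k A h => // k IH A h Ak hinj.
have [AT|] := eqVneq (~: A) finset.set0.
  have AE x : x \in A by have := finset.in_set0 x; rewrite -AT !inE => /negbT/negPn.
  have {}hinj : injective h by move=> x y; apply: hinj.
  by exists (perm hinj) => x _; rewrite permE.
move=> /set0Pn[x]; rewrite inE => xA.
have [y yA] : exists y, y \notin h @: A.
  apply/existsP; rewrite -negb_forall; apply/negP => /forallP hA.
  have : (#|I| <= #|h @: A|)%N by apply/subset_leq_card/fintype.subsetP => z _.
  rewrite card_in_imset// leqNgt => /negP; apply.
  by rewrite -cardsT proper_card// properE finset.subsetT; apply/subsetPn; exists x.
pose h' z := if z == x then y else h z.
have [| |s sE] := IH (x |: A) h'.
- rewrite -ltnS (leq_trans _ Ak)// ltnS proper_card// properE; apply/andP; split.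
    by rewrite finset.setCS finset.subsetUr.
  by apply/subsetPn; exists x; rewrite !inE ?xA ?eqxx.
- move=> z1 z2; rewrite !inE /h'.
  case: eqVneq => [->|_] /=; case: eqVneq => [->|_] //= A1 A2.
  + by move=> yE; case/negP: yA; rewrite yE imset_f.
  + by move=> yE; case/negP: yA; rewrite -yE imset_f.
  + exact: hinj.
exists s => z zA; rewrite sE /h' ?inE ?zA ?orbT//.
by case: eqVneq => // zx; rewrite -zx zA in xA.
Qed.

Section MonomialAction.
Context (R : realType) (G : groupType) (X : Type).
Context (act : G -> X -> X) (c : G -> X -> R[i]) (n : nat) (w : 'I_n -> X).
Hypothesis act_inj : forall g, injective (act g).
Hypothesis actM : forall g h x, act (g * h)%g x = act g (act h x).
Hypothesis c1 : forall g x, `|c g x| = 1.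
Hypothesis cM : forall g h x, c (g * h)%g x = c g (act h x) * c h x.
Hypothesis w_inj : injective w.

Definition escaping g : {set 'I_n} :=
  [set i | ~~ `[< exists j, act g (w i) = w j >]]%SET.

(** Where h w_i and (g h) w_i both stay in the sample, the completed permutations
compose as the action does and the cocycle identity makes the phases agree; so
only escaping indices contribute to the multiplicative defect. *)
Lemma monomial_almost_hom : exists f : G -> 'M[R[i]]_n,
  [/\ forall g, f g \is unitarymx,
      forall g h, dHS (f g *m f h) (f (g * h)%g) ^+ 2 <=
        n%:R^-1 * (4 * (#|escaping h|%:R + #|escaping (g * h)%g|%:R))
    & forall g, (forall i, act g (w i) = w i) ->
        f g = diag_mx (\row_i c g (w i))].
Proof.
have sP g : exists s : {perm 'I_n},
    forall i j, act g (w i) = w j -> s i = j.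
  have /choice[h hP] i : exists j, i \notin escaping g -> act g (w i) = w j.
    rewrite inE; case: asboolP => [[j ij]|_]; first by exists j.
    by exists i.
  have [|s sE] := @extend_partial_perm _ (~: escaping g) h.
    move=> i j; rewrite !finset.in_setC => Ai Aj hij.
    by apply: w_inj; apply: (@act_inj g); rewrite (hP i Ai) (hP j Aj) hij.
  exists s => i j ij.
  have iA : i \notin escaping g by rewrite inE negbK; apply/asboolP; exists j.
  by apply: w_inj; rewrite sE ?finset.in_setC// -hP.
have [s sE] := choice sP.
exists (fun g => monomialmx (s g) (fun j => c g (w j))); split.
- by move=> g; exact: monomialmx_unitary.
- move=> g h; rewrite monomialmx_mul.
  apply: le_trans (dHS_monomialmx _ _ _ _) _ => [j|j|].
  + by rewrite normrM !c1 mulr1.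
  + exact: c1.
  rewrite ler_wpM2l ?invr_ge0// ler_wpM2l// -natrD ler_nat.
  apply: leq_trans (leq_card_setU _ _); apply/subset_leq_card/fintype.subsetP => j.
  rewrite !inE; apply: contraR; rewrite negb_or !negbK => /andP[/asboolP[k hk] /asboolP[l gl]].
  rewrite permM (sE h _ _ hk) (sE _ _ _ gl) -hk -cM eqxx andbT.
  by apply/eqP/sE; rewrite -hk -actM.
- move=> g gw; rewrite -monomialmx1; congr monomialmx; apply/permP => i.
  by rewrite perm1; apply: sE.
Qed.

End MonomialAction.

(** * Samples of weighted sets *)

Lemma big_option (V : Type) (idx : V) (op : Monoid.com_law idx) (T : finType)
    (F : option T -> V) :
  \big[op/idx]_x F x = op (F None) (\big[op/idx]_y F (Some y)).
Proof.
rewrite (bigD1 None)//= (reindex_omap Some id) => [|[x|]//] /=.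
by congr (op _ _); apply: eq_bigl => x; rewrite eqxx.
Qed.

Section Sampling.
Context (R : realType).

(** A multiset with multiplicities M, enumerated by stacking M x layers over each
point x. *)
Lemma enum_layers (U : finType) (M : U -> nat) n : (\sum_x M x)%N = n ->
  exists w : 'I_n -> U * nat, [/\ injective w,
    forall x a, (a < M x)%N -> exists i, w i = (x, a)
    & forall phi : U * nat -> R,
        \sum_i phi (w i) = \sum_x \sum_(a < M x) phi (x, a : nat)].
Proof.
pose I := {x : U & 'I_(M x)} => Mn.
have In : #|{: I}| = n.
  rewrite card_tagged sumnE big_map big_enum -Mn /=.
  by apply: eq_bigr => x _; rewrite card_ord.
pose h (i : 'I_n) : I := enum_val (cast_ord (esym In) i).
have hbij : bijective h.
  exists (fun x => cast_ord In (enum_rank x)) => x; rewrite /h.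
    by rewrite enum_valK cast_ordKV.
  by rewrite cast_ordK enum_rankK.
pose w0 (x : I) : U * nat := (tag x, nat_of_ord (tagged x)).
exists (fun i => w0 (h i)); split.
- have w0_inj : injective w0.
    by move=> [x a] [y b]; rewrite /w0 /= => -[xy]; case: y / xy b => b /ord_inj ->.
  by move=> i j /w0_inj /(bij_inj hbij).
- move=> x a aM; have [h' _ hK] := hbij.
  by exists (h' (Tagged (fun x => 'I_(M x)) (Ordinal aM))); rewrite hK.
- move=> phi; rewrite (sig_big_dep xpredT (fun _ => xpredT)
    (fun x (a : 'I_(M x)) => phi (x, a : nat)))/=.
  by rewrite (reindex h) /=; [exact: eq_bigr|exact: onW_bij].
Qed.

(** Each weight is rounded down; the extra point None absorbs the missing mass, so
that the total is exactly n. *)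
Lemma round_weights (T : finType) (W : T -> R) n :
  (forall x, 0 <= W x) -> \sum_x W x = 1 ->
  exists M : option T -> nat, [/\ (\sum_x M x)%N = n,
    forall x, n%:R * W x - 1 <= (M (Some x))%:R <= n%:R * W x
    & (M None <= #|T|)%N].
Proof.
move=> W0 W1; pose M x := Num.truncn (n%:R * W x).
have MP x : n%:R * W x - 1 <= (M x)%:R <= n%:R * W x.
  have /truncn_itv/andP[-> h] : 0 <= n%:R * W x by rewrite mulr_ge0.
  by rewrite andbT lerBlDr natr1 ltW.
have nW : \sum_x n%:R * W x = n%:R by rewrite -mulr_sumr W1 mulr1.
have Mn : (\sum_x M x <= n)%N.
  rewrite -(ler_nat R) natr_sum -[leRHS]nW.
  by apply: ler_sum => x _; have /andP[] := MP x.
exists (fun x => if x is Some y then M y else (n - \sum_x M x)%N); split=> //.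
  by rewrite big_option /= subnK.
rewrite leq_subLR -(ler_nat R) natrD natr_sum -[leLHS]nW.
rewrite -sum1_card natr_sum -big_split/=; apply: ler_sum => x _.
by rewrite -lerBlDr; have /andP[] := MP x.
Qed.

Lemma sum_bool_layers (b : nat -> bool) (m m' : nat) :
  (forall a, (a < m')%N -> ~~ b a) -> (\sum_(a < m) b a <= m - m')%N.
Proof.
move=> bm; elim: m => [|m IH]; first by rewrite big_ord0.
rewrite big_ord_recr/=; have [/bm/negbTE ->|mm] := ltnP m m'.
  by rewrite addn0 (leq_trans IH)// leq_sub2r.
by rewrite subSn// -addn1 leq_add// leq_b1.
Qed.

(** A sample of size n whose points (q t, j) are repeated about n * p (q t) * rho j
times. The layers over (q t, j) and over its translate differ in number by
about n * rho j * |p (q t) - p (g (q t))|, and layers with the same number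
correspond under g; this bounds the escaping part. The padding by copies of
q0 (label None) and the rounding only cost a multiple of the number a * m of
points, which is independent of n. *)
Lemma weighted_sample (G : groupType) (Q : eqType) (act : G -> Q -> Q)
    (a m n : nat) (q : 'I_a -> Q) (p : Q -> R) (rho : 'I_m -> R) (q0 : Q) :
  injective q -> (forall x, 0 <= p x) ->
  (forall x, (forall t, q t != x) -> p x = 0) -> \sum_t p (q t) = 1 ->
  (forall j, 0 <= rho j) -> \sum_j rho j = 1 ->
  exists w : 'I_n -> Q * (option 'I_m * nat), [/\ injective w,
    forall (g : G) (eps : R),
      \sum_t `|p (q t) - p (act g (q t))| <= eps ->
      #|escaping (fun g x => (act g x.1, x.2)) w g|%:R <=
        n%:R * eps + 2 * (a * m)%:R
  & forall (psi : Q -> option 'I_m -> R) (B : R), (forall x j, `|psi x j| <= B) ->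
      `|\sum_i psi (w i).1 (w i).2.1 -
        n%:R * \sum_t \sum_j p (q t) * rho j * psi (q t) (Some j)| <=
      2 * ((a * m)%:R * B)].
Proof.
move=> q_inj p0 p_supp p1 rho0 rho1.
pose T : finType := ('I_a * 'I_m)%type.
pose W (x : T) := p (q x.1) * rho x.2.
have cT : #|T| = (a * m)%N by rewrite card_prod !card_ord.
have [||M [Mn MW MN]] := @round_weights T W n.
- by move=> x; rewrite mulr_ge0.
- rewrite /W -(pair_bigA _ (fun t j => p (q t) * rho j))//= -p1.
  by apply: eq_bigr => t _; rewrite -mulr_sumr rho1 mulr1.
have [v [v_inj vM v_sum]] := enum_layers Mn.
pose e (x : option T * nat) : Q * (option 'I_m * nat) :=
  if x.1 is Some y then (q y.1, (Some y.2, x.2)) else (q0, (None, x.2)).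
have e_inj : injective e.
  by move=> [[[t j]|] b] [[[t' j']|] b'] //= [] => [/q_inj-> -> ->|->].
exists (e \o v); split; first exact: inj_comp.
- move=> g eps geps; set E := escaping _ _ _.
  pose out (x : option T * nat) : bool :=
    ~~ `[< exists j, (act g (e x).1, (e x).2) = e (v j) >].
  have -> : #|E|%:R = \sum_i (out (v i))%:R :> R.
    rewrite -sum1_card natr_sum big_mkcond/=; apply: eq_bigr => i _.
    by rewrite inE -/(out (v i)); case: out.
  rewrite (v_sum (fun x => (out x)%:R)) big_option /=.
  have -> : n%:R * eps + 2 * (a * m)%:R =
    (a * m)%:R + (n%:R * eps + (a * m)%:R) by lra.
  rewrite lerD//.
    rewrite -natr_sum ler_nat -cT; apply: leq_trans MN.
    rewrite -[leqRHS]subn0.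
    by apply: (@sum_bool_layers (fun b => out (None, b)) _ 0) => b; rewrite ltn0.
  (* If g moves q x.1 to a point q t of the support, the layers below
     M (Some (t, x.2)) do not escape; otherwise p vanishes at the translate and
     all layers may escape. *)
  have outE (x : T) : \sum_(b < M (Some x)) (out (Some x, b : nat))%:R <=
      n%:R * (rho x.2 * `|p (q x.1) - p (act g (q x.1))|) + 1 :> R.
    have /andP[_ Mx] := MW x.
    have [[t tE]|nt] := pselect (exists t, q t = act g (q x.1)).
      have /andP[My _] := MW (t, x.2).
      rewrite -natr_sum; apply: (@le_trans _ _ (M (Some x) - M (Some (t, x.2)))%:R).
        rewrite ler_nat; apply: (@sum_bool_layers (fun b => out (Some x, b))) => b bM.
        rewrite negbK; apply/asboolP; have [j vj] := vM _ _ bM.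
        by exists j; rewrite vj /e /= tE.
      have [le_M|/ltnW lt_M] := leqP (M (Some x)) (M (Some (t, x.2))).
        by rewrite -subn_eq0 in le_M; rewrite (eqP le_M) addr_ge0// !mulr_ge0.
      rewrite natrB//; move: Mx My; rewrite /W /= -tE.
      have : n%:R * (rho x.2 * (p (q x.1) - p (q t))) <=
             n%:R * (rho x.2 * `|p (q x.1) - p (q t)|).
        by rewrite !ler_wpM2l// ler_norm.
      by nra.
    have -> : p (act g (q x.1)) = 0.
      by apply: p_supp => t; apply/eqP => tE; apply: nt; exists t.
    rewrite subr0 ger0_norm// -natr_sum.
    apply: (@le_trans _ _ (M (Some x))%:R).
      rewrite ler_nat -[leqRHS]subn0.
      by apply: (@sum_bool_layers (fun b => out (Some x, b)) _ 0) => b; rewrite ltn0.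
    by rewrite (le_trans Mx)// /W [_ * rho _]mulrC lerDl.
  apply: le_trans (ler_sum _ (fun x _ => outE x)) _.
  rewrite big_split/= sumr_const cT lerD2r -mulr_sumr ler_wpM2l//.
  rewrite -(pair_bigA _ (fun t j => rho j * `|p (q t) - p (act g (q t))|))//=.
  apply: le_trans geps; apply: ler_sum => t _.
  by rewrite -mulr_suml rho1 mul1r.
- move=> psi B psiB.
  pose phi (x : option T * nat) := psi (e x).1 (e x).2.1.
  rewrite [X in X - _](_ : _ = \sum_i phi (v i))// v_sum big_option /=.
  rewrite pair_bigA/=.
  rewrite mulr_sumr -addrA -sumrB.
  have -> : 2 * ((a * m)%:R * B) = (a * m)%:R * B + (a * m)%:R * B by lra.
  rewrite (le_trans (ler_normD _ _))// lerD//.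
    rewrite /phi /= sumr_const card_ord normrMn -[leLHS]mulr_natl.
    by rewrite ler_pM// ?ler_nat -?cT// psiB.
  rewrite (le_trans (ler_norm_sum _ _ _))//.
  rewrite -cT -sum1_card natr_sum mulr_suml; apply: ler_sum => x _.
  rewrite mul1r /phi /= sumr_const card_ord -[_ *+ _]mulr_natl mulrA -mulrBl.
  rewrite normrM -[leRHS]mul1r ler_pM// ?psiB//.
  have /andP[h1 h2] := MW x; rewrite ler_norml; apply/andP; split.
    by move: h1; rewrite /W; lra.
  by move: h2; rewrite /W; lra.
Qed.

End Sampling.

(** * Borel probability measures on compact spaces *)

Section BorelProbability.
Context (R : realType) (X : ptopologicalType).
Hypothesis X_compact : compact [set: X].
Implicit Types (mu : probability (borel X) R) (phi : X -> R).

Lemma continuous_bounded phi : continuous phi -> exists B, forall x, `|phi x| <= B.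
Proof.
move=> cphi; have /compact_bounded[M [_ MP]] : compact (phi @` [set: X]).
  by apply: continuous_compact => //; exact: continuous_subspaceT.
by exists (M + 1) => x; apply: MP; [rewrite ltrDl|exists x].
Qed.

Lemma open_borel (U : set X) : open U -> measurable (U : set (borel X)).
Proof. exact: sub_sigma_algebra. Qed.

Lemma continuous_borel phi : continuous phi ->
  measurable_fun [set: borel X] (phi : borel X -> R).
Proof.
move=> /continuousP cphi; apply: (measurability _ (RGenOpens.measurableE R)).
move=> _ [_ [a [b ->] <-]]; rewrite setTI; apply: open_borel.
exact/cphi/interval_open.
Qed.

Lemma continuous_borel_map (T : X -> X) : continuous T ->
  measurable_fun [set: borel X] (T : borel X -> borel X).
Proof.
move=> /continuousP cT; apply: (@measurability _ _ (borel X) (borel X) _ _ (@open X)) => //.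
by move=> _ [U oU <-]; rewrite setTI; apply: open_borel; exact: cT.
Qed.

Lemma bounded_integrable mu (f : borel X -> R) (B : R) :
  measurable_fun [set: borel X] f -> (forall x, `|f x| <= B) ->
  mu.-integrable [set: borel X] (EFin \o f).
Proof.
move=> mf fB; apply: measurable_bounded_integrable => //.
  by rewrite [X in (X < _)%E](_ : _ = 1%E) ?ltry//; exact: probability_setT.
exists B; split; first exact: num_real.
by move=> K /ltW BK x _; exact: le_trans (fB x) BK.
Qed.

Lemma continuous_integrable mu phi : continuous phi ->
  mu.-integrable [set: borel X] (EFin \o phi).
Proof.
move=> cphi; have [B phiB] := continuous_bounded cphi.
exact: bounded_integrable (continuous_borel cphi) phiB.
Qed.

Lemma Rintegral_comp mu (T : X -> X) phi : continuous T -> continuous phi ->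
  (forall A : set (borel X), measurable A -> mu (T @^-1` A) = mu A) ->
  \int[mu]_(x in [set: borel X]) phi (T x) = \int[mu]_(x in [set: borel X]) phi x.
Proof.
move=> cT cphi muT.
have mT := continuous_borel_map cT.
have mphi : measurable_fun [set: borel X] (EFin \o phi).
  exact: (@measurable_EFinP _ (borel X) R [set: borel X] phi).2 (continuous_borel cphi).
have iphi : mu.-integrable (T @^-1` [set: borel X]) ((EFin \o phi) \o T).
  rewrite preimage_setT; apply: (@continuous_integrable mu (phi \o T)).
  by move=> x; apply: continuous_comp; [exact: cT|exact: cphi].
have := integral_pushforward mT mphi iphi measurableT.
rewrite preimage_setT /Rintegral => e; congr fine.
rewrite -[LHS]e; apply: eq_measure_integral => A mA _.
exact: muT.
Qed.

Lemma Rintegral_simple mu m (a : 'I_m -> R) (A : 'I_m -> set (borel X)) :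
  (forall j, measurable (A j)) ->
  \int[mu]_(x in [set: borel X]) (\sum_j a j * \1_(A j) x) =
  \sum_j a j * fine (mu (A j)).
Proof.
move=> mA.
have ind_le (B : set (borel X)) x : `|\1_B x| <= 1 :> R.
  by rewrite indicE; case: (_ \in _); rewrite ?normr1 ?normr0.
have imA j : mu.-integrable [set: borel X] (EFin \o \1_(A j)).
  exact: bounded_integrable (measurable_indic (mA j)) (ind_le _).
elim: m a A mA imA => [|m IH] a A mA imA.
  rewrite big_ord0; under eq_Rintegral do rewrite big_ord0.
  by rewrite Rintegral_cst// mul0r.
rewrite big_ord_recl; under eq_Rintegral do rewrite big_ord_recl.
have mZ (b : R) (C : set (borel X)) : measurable C ->
    measurable_fun [set: borel X] (fun x => b * \1_C x : R).
  by move=> mC; apply: measurable_funM => //; exact: measurable_indic.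
rewrite RintegralD//=.
- rewrite IH//; congr (_ + _); rewrite RintegralZl//; congr (_ * _).
  by rewrite /Rintegral integral_indic// setIT.
- apply: (@bounded_integrable _ _ `|a ord0|); first exact: mZ.
  by move=> x; rewrite normrM ler_piMr.
- apply: (@bounded_integrable _ _ (\sum_(j < m) `|a (lift ord0 j)|)).
    by apply: measurable_sum => j; exact: mZ.
  move=> x; rewrite (le_trans (ler_norm_sum _ _ _))//.
  by apply: ler_sum => j _; rewrite normrM ler_piMr.
Qed.

Lemma continuous_lincomb m (a : 'I_m -> R) (phi : 'I_m -> X -> R) :
  (forall t, continuous (phi t)) -> continuous (fun x => \sum_t a t * phi t x).
Proof.
move=> cphi x; have xF : Filter (nbhs x) by exact: nbhs_filter.
apply: (@cvg_big R _ +%R 0 xpredT _ _ (nbhs x)) => [|t _].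
  by move=> z; apply: (@cvgD _ R^o); [exact: cvg_fst|exact: cvg_snd].
by apply: cvgM; [exact: cvg_cst|exact: cphi].
Qed.

Lemma Rintegral_lincomb mu m (a : 'I_m -> R) (phi : 'I_m -> X -> R) :
  (forall t, continuous (phi t)) ->
  \int[mu]_(x in [set: borel X]) (\sum_t a t * phi t x) =
  \sum_t a t * \int[mu]_(x in [set: borel X]) phi t x.
Proof.
elim: m a phi => [|m IH] a phi cphi.
  rewrite big_ord0; under eq_Rintegral do rewrite big_ord0.
  by rewrite Rintegral_cst// mul0r.
rewrite big_ord_recl; under eq_Rintegral do rewrite big_ord_recl.
rewrite RintegralD//=.
- by rewrite IH// RintegralZl//; exact: continuous_integrable.
- apply: (@continuous_integrable mu (fun x => a ord0 * phi ord0 x)) => x.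
  by apply: cvgM; [exact: cvg_cst|exact: cphi].
- apply: (@continuous_integrable mu
    (fun x => \sum_(i < m) a (lift ord0 i) * phi (lift ord0 i) x)).
  exact: continuous_lincomb.
Qed.

(** Cut the space into finitely many Borel pieces, each inside some V y, and give y
the mass of its piece. The sets V are fixed before phi, so that one choice of
points serves all functions with the same oscillation. *)
Lemma quantization mu (V : X -> set X) :
  (forall x, open (V x)) -> (forall x, V x x) ->
  exists m (y : 'I_m -> X) (rho : 'I_m -> R),
    [/\ forall j, 0 <= rho j, \sum_j rho j = 1
      & forall phi (e : R), continuous phi ->
          (forall x z, V x z -> `|phi x - phi z| <= e) ->
          `|\int[mu]_(x in [set: borel X]) phi x - \sum_j rho j * phi (y j)| <= e].
Proof.
move=> oV Vx.
have [m [y yV]] : exists m (y : nat -> X), forall x, exists2 j, (j < m)%N & V (y j) x.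
  move: X_compact; rewrite compact_cover => /(_ X setT V) [||D _ DV].
  - by move=> x _; exact: oV.
  - by move=> x _; exists x => //; exact: Vx.
  exists (size (finmap.enum_fset D)), (nth point (finmap.enum_fset D)) => x.
  have [z zD Vzx] := DV x I.
  exists (index z (finmap.enum_fset D)); first by rewrite index_mem.
  by rewrite nth_index.
pose F j : set (borel X) := V (y j).
pose A j := seqDU F j.
have mF j : measurable (F j) by apply: open_borel; exact: oV.
have mA j : measurable (A j).
  by apply: measurableD => //; apply: bigsetU_measurable.
have AF j : A j `<=` F j by apply: subDsetl.
have AT x : exists2 j, (j < m)%N & A j x.
  have [j jm Fjx] := yV x.
  have : (\big[setU/set0]_(i < m) A i) x.
    by rewrite /A -bigsetU_seqDU -bigcup_mkord; exists j.
  by rewrite -bigcup_mkord => -[i im Aix]; exists i.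
have Adisj x i j : A i x -> A j x -> i = j.
  by move=> Ai Aj; apply: (@trivIset_seqDU _ F i j) => //; exists x.
pose rho (j : 'I_m) := fine (mu (A j)).
have sum_ind x (a : 'I_m -> R) j : A (nat_of_ord j) x ->
    \sum_i a i * \1_(A i) x = a j.
  move=> Ajx; rewrite (bigD1 j)//= big1 => [|i ij].
    by rewrite addr0 indicE mem_set// mulr1.
  rewrite indicE memNset ?mulr0// => Aix.
  by case/eqP: ij; apply/val_inj; exact: (Adisj x).
have rhoE (a : 'I_m -> R) : \sum_j rho j * a j =
    \int[mu]_(x in [set: borel X]) (\sum_(j < m) a j * \1_(A j) x).
  by rewrite Rintegral_simple//; apply: eq_bigr => j _; rewrite mulrC.
exists m, (fun j => y j), rho; split.
- by move=> j; rewrite fine_ge0.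
- under eq_bigr do rewrite -[rho _]mulr1.
  rewrite rhoE -[RHS]mul1r -[X in _ = _ * X](_ : fine (mu [set: borel X]) = 1); last first.
    by rewrite (probability_setT mu).
  rewrite -Rintegral_cst//; apply: eq_Rintegral => x _.
  by have [j jm Ajx] := AT x; rewrite (sum_ind x (fun=> 1) (Ordinal jm)).
move=> phi e cphi phiV; rewrite rhoE.
have [B phiB] := continuous_bounded cphi.
pose s x : R := \sum_(j < m) phi (y j) * \1_(A j) x.
have s_phi x : `|phi x - s x| <= e.
  have [j jm Ajx] := AT x.
  rewrite /s (sum_ind x (fun j => phi (y j)) (Ordinal jm))// distrC.
  by apply: phiV; exact: (AF j).
have ms : measurable_fun [set: borel X] s.
  by apply: measurable_sum => j; apply: measurable_funM => //; exact: measurable_indic.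
have is_ : mu.-integrable [set: borel X] (EFin \o s).
  apply: (@bounded_integrable _ _ B) => // x; have [j jm Ajx] := AT x.
  by rewrite /s (sum_ind x (fun j => phi (y j)) (Ordinal jm)).
have iphi := continuous_integrable mu cphi.
rewrite -RintegralB//.
have md : measurable_fun [set: borel X] (fun x => phi x - s x).
  by apply: measurable_funB => //; exact: continuous_borel.
have id_ : mu.-integrable [set: borel X] (EFin \o (fun x => phi x - s x)).
  exact: bounded_integrable md s_phi.
apply: le_trans (le_normr_Rintegral _ id_) _ => //.
rewrite -[leRHS]mulr1 -[X in _ * X](_ : fine (mu [set: borel X]) = 1); last first.
  by rewrite (probability_setT mu).
rewrite -Rintegral_cst//; apply: le_Rintegral => //.
- apply: (@bounded_integrable _ _ e); first exact: measurableT_comp.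
  by move=> x; rewrite normr_id.
- by apply: (@bounded_integrable _ _ `|e|).
Qed.

End BorelProbability.

Section Empirical.
Context (R : realType) (X : ptopologicalType) (n : nat) (c : 'I_n.+1 -> X).

Definition empirical : set (borel X) -> \bar R :=
  mscale (n.+1%:R^-1)%:nng (msum (fun k => \d_(c (inord k) : borel X)) n.+1).

HB.instance Definition _ := Measure.on empirical.

Lemma empiricalE (A : set (borel X)) :
  empirical A = (n.+1%:R^-1 * \sum_i \1_A (c i))%:E.
Proof.
rewrite /empirical /mscale /msum /= EFinM -sumEFin; congr (_ * _)%E.
by apply: eq_bigr => i _; rewrite inord_val.
Qed.

Fact empirical_setT : empirical [set: _] = 1%E.
Proof.
rewrite empiricalE; under eq_bigr do rewrite indicT.
by rewrite sumr_const card_ord mulVf.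
Qed.

HB.instance Definition _ := Measure_isProbability.Build _ _ _ empirical empirical_setT.

(** The formulas for integrals against sums of measures require nonnegative
functions, hence the shift of phi by a bound B. *)
Lemma Rintegral_empirical (phi : X -> R) : compact [set: X] -> continuous phi ->
  \int[empirical]_(x in [set: borel X]) phi x = n.+1%:R^-1 * \sum_i phi (c i).
Proof.
move=> cX cphi; have [B phiB] := continuous_bounded cX cphi.
have pos (f : X -> R) : continuous f -> (forall x, 0 <= f x) ->
    \int[empirical]_(x in [set: borel X]) f x = n.+1%:R^-1 * \sum_i f (c i).
  move=> cf f0.
  have mf : measurable_fun [set: borel X] (EFin \o f).
    exact: (@measurable_EFinP _ (borel X) R [set: borel X] f).2 (continuous_borel cf).
  rewrite /Rintegral /empirical ge0_integral_mscale//=; last by move=> x _; rewrite lee_fin.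
  rewrite ge0_integral_measure_sum//; last by move=> x _; rewrite lee_fin.
  rewrite (eq_bigr (fun i => (f (c i))%:E)) => [|i _]; last first.
    by rewrite integral_dirac// diracT mul1e inord_val.
  by rewrite sumEFin.
have cB : continuous (fun _ : X => B : R) by move=> x; exact: cvg_cst.
have cphiB : continuous (fun x => phi x + B).
  by move=> x; apply: cvgD; [exact: cphi|exact: cvg_cst].
have := pos _ cphiB; rewrite RintegralD//; last 2 first.
- exact: continuous_integrable.
- exact: continuous_integrable.
rewrite Rintegral_cst// [X in B * X](_ : _ = 1); last first.
  by move: empirical_setT => /(congr1 fine).
rewrite mulr1 big_split/= sumr_const card_ord.
rewrite mulrDr -[B *+ _]mulr_natl mulKf// => /(_ _)/addIr; apply=> x.
by have := phiB x; rewrite ler_norml => /andP[h _]; rewrite -lerBlDr sub0r.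
Qed.

End Empirical.

(** * The topology of the dual group *)

Section CharacterDistance.
Context (R : realType) (H : groupType) (en : nat -> H).
Hypothesis en_surj : forall x, exists i, en i = x.
Local Notation D := (dual R H).
Implicit Types (chi psi xi : D).

Lemma nonexpansive_continuous (f : R[i] -> R) :
  (forall z w, `|f z - f w|%:C%C <= `|z - w|) -> continuous (f : R[i]^o -> R).
Proof.
move=> fle z; have zF : Filter (nbhs (z : R[i]^o)) by exact: nbhs_filter.
apply/(@cvgrPdist_lt R R^o _ _ zF) => e e0.
have eC0 : 0 < e%:C%C :> R[i] by rewrite ltcR.
near=> w.
have zw : `|z - w| < e%:C%C.
  by near: w; exact: (@cvgr_dist_lt _ _ _ _ _ id (z : R[i]^o) cvg_id _ eC0).
by rewrite -ltcR; exact: le_lt_trans (fle z w) zw.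
Unshelve. all: by end_near.
Qed.

Lemma Re_continuous : continuous (fun z : R[i]^o => complex.Re z : R).
Proof.
by apply: nonexpansive_continuous => z w; rewrite -raddfB; exact: normc_ge_Re.
Qed.

Lemma Im_continuous : continuous (fun z : R[i]^o => complex.Im z : R).
Proof.
apply: nonexpansive_continuous => -[a b] [c d] /=.
rewrite normc_def lecR /= -sqrtr_sqr ler_wsqrtr// lerDr.
exact: sqr_ge0.
Qed.

(** A quadratic cost, rather than a metric: summed over matrix entries it becomes
a squared Hilbert-Schmidt distance. *)
Definition char_dist k chi psi : R :=
  \sum_(i < k) sqmod (sval chi (en i) - sval psi (en i)).

Lemma char_dist_ge0 k chi psi : 0 <= char_dist k chi psi.
Proof. by apply: sumr_ge0 => i _; exact: sqmod_ge0. Qed.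

Lemma char_dist_refl k chi : char_dist k chi chi = 0.
Proof. by rewrite /char_dist big1// => i _; rewrite subrr sqmod0. Qed.

Lemma char_dist_triangle k chi psi xi :
  char_dist k chi xi <= 2 * (char_dist k chi psi + char_dist k psi xi).
Proof.
rewrite -big_split mulr_sumr/=; apply: ler_sum => i _.
by rewrite -(subrKA (sval psi (en i))); exact: sqmodD_le.
Qed.

Lemma char_dist_mono k l chi psi : (k <= l)%N ->
  char_dist k chi psi <= char_dist l chi psi.
Proof.
move=> kl; rewrite /char_dist.
rewrite (big_ord_widen l (fun i => sqmod (sval chi (en i) - sval psi (en i))))//.
rewrite [leRHS](bigID (fun i : 'I_l => (i < k)%N))/= lerDl.
by apply: sumr_ge0 => i _; exact: sqmod_ge0.
Qed.

Lemma char_dist_continuous k chi : continuous (char_dist k chi : D -> R).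
Proof.
move=> psi; have psiF : Filter (nbhs psi) by exact: nbhs_filter.
apply: (@cvg_big R _ +%R 0 xpredT _ _ (nbhs psi)) => [|i _].
  by move=> x; apply: (@cvgD _ R^o); [exact: cvg_fst|exact: cvg_snd].
have cd : (fun xi : D => sval chi (en i) - sval xi (en i) : R[i]^o) @ psi -->
    (sval chi (en i) - sval psi (en i) : R[i]^o).
  by apply: cvgB; [exact: cvg_cst|exact: ev_continuous].
have cRe := cvg_comp _ _ cd (@Re_continuous _).
have cIm := cvg_comp _ _ cd (@Im_continuous _).
by apply: cvgD; rewrite !expr2; apply: cvgM.
Qed.

(** These balls form a neighbourhood basis for pointwise convergence since en is
surjective and char_dist increases with k. *)
Lemma char_dist_nbhs chi (A : set D) : nbhs chi A ->
  exists k, [set psi | char_dist k chi psi < k.+1%:R^-1] `<=` A.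
Proof.
move=> chiA.
pose B k := [set psi : D | char_dist k chi psi < k.+1%:R^-1].
have B_mono k l : (k <= l)%N -> B l `<=` B k.
  move=> kl psi; rewrite /B /= => h.
  apply: le_lt_trans (char_dist_mono _ _ kl) (lt_le_trans h _).
  by rewrite lef_pV2 ?posrE ?ltr0Sn// ler_nat.
pose F := filter_from [set: nat] B.
have FF : Filter F.
  apply: filter_from_filter; first by exists 0%N.
  move=> k l _ _; exists (maxn k l) => // psi h.
  by split; apply: B_mono h; rewrite ?leq_maxl ?leq_maxr.
suff /(_ A chiA) [k _ kA] : F --> chi by exists k.
apply/cvg_dual => x; apply/cvgrPdist_lt => eps eps0.
have [r r0 er] : exists2 r : R, 0 < r & eps = r%:C%C.
  exists (complex.Re eps); move: eps0; rewrite ltcE /= => /andP[/eqP im0 re0] //.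
  by case: eps im0 re0 => a b /= -> _.
have [i ei] := en_surj x.
pose k := maxn i.+1 (Num.truncn (r ^+ 2)^-1).
exists k => // psi /=; rewrite /B /= => h.
rewrite er normc_def ltcR -(@ltr_pXn2r _ 2)// ?nnegrE ?sqrtr_ge0 ?ltW// sqr_sqrtr; last first.
  exact: sqmod_ge0.
apply: (@le_lt_trans _ _ (char_dist k chi psi)).
  have ik : (i < k)%N by rewrite leq_maxl.
  rewrite /char_dist (bigD1 (Ordinal ik))//= ei lerDl.
  by apply: sumr_ge0 => j _; exact: sqmod_ge0.
apply: lt_trans h _.
rewrite invf_plt ?posrE ?ltr0Sn ?exprn_gt0//.
apply: lt_le_trans (truncnS_gt _) _.
by rewrite ler_nat ltnS leq_maxr.
Qed.

(** Uniform continuity. If the cost is small the values of phi are close by local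
continuity and compactness; if it is not, k times the cost exceeds the
oscillation 2 B of phi once k is large. *)
Lemma char_dist_modulus (phi : D -> R) (e : R) : continuous phi -> 0 < e ->
  exists k, forall chi psi, `|phi chi - phi psi| <= e + k%:R * char_dist k chi psi.
Proof.
move=> cphi e0; have [B phiB] := continuous_bounded (@dual_compact R H) cphi.
pose P (k : nat) chi :=
  forall psi, `|phi chi - phi psi| <= e + k%:R * char_dist k chi psi.
have /compact_near_coveringP/(_ nat \oo P _)[] := @dual_compact R H.
  move=> chi0 _.
  have e20 : 0 < e / 2 by rewrite divr_gt0.
  have /char_dist_nbhs[k0 k0P] : nbhs chi0 [set psi | `|phi chi0 - phi psi| < e / 2].
    by have /cvgrPdist_lt/(_ _ e20) := cphi chi0.
  pose r : R := k0.+1%:R^-1.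
  have r0 : 0 < r by rewrite invr_gt0 ltr0Sn.
  have r4r : r / 4 < r by rewrite ltr_pdivrMr// ltr_pMr// ltr1n.
  have {}k0P psi : char_dist k0 chi0 psi < r -> `|phi chi0 - phi psi| < e / 2.
    exact: k0P.
  pose k1 := maxn k0 (Num.truncn (2 * B / (r / 4))).+1.
  exists ([set chi | char_dist k0 chi0 chi < r / 4], [set k | (k1 <= k)%N]) => /=.
    split; last by exists k1.
    have r40 : 0 < r / 4 by rewrite divr_gt0.
    have := @char_dist_continuous k0 chi0 chi0.
    move=> /cvgr_lt; rewrite char_dist_refl => /(_ _ r40).
    by [].
  move=> [chi k] /= [h k1k] psi.
  have k0k : (k0 <= k)%N by apply: leq_trans k1k; rewrite leq_maxl.
  have [near|far] := ltP (char_dist k chi psi) (r / 4).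
    have h1 : `|phi chi0 - phi chi| < e / 2 by apply: (k0P); apply: lt_trans h r4r.
    have h2 : `|phi chi0 - phi psi| < e / 2.
      apply: (k0P); apply: le_lt_trans (char_dist_triangle _ _ chi _) _.
      by have := char_dist_mono chi psi k0k; lra.
    have := ler_distD (phi chi0) (phi chi) (phi psi); rewrite (distrC (phi chi) (phi chi0)).
    by have := mulr_ge0 (ler0n R k) (char_dist_ge0 k chi psi); lra.
  have B2 : 2 * B <= k%:R * char_dist k chi psi.
    apply: (@le_trans _ _ (k%:R * (r / 4))); last by rewrite ler_wpM2l.
    rewrite -ler_pdivrMr ?divr_gt0//; apply: ltW.
    apply: lt_le_trans (truncnS_gt _) _; rewrite ler_nat.
    by apply: leq_trans k1k; rewrite leq_maxr.
  have := ler_normB (phi chi) (phi psi); have := phiB chi; have := phiB psi.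
  by lra.
by move=> k _ /(_ k (leqnn _)) kP; exists k => chi psi; exact: kP.
Qed.

End CharacterDistance.

(** * Matrix models of an invariant measure *)

Lemma inv_mul_le_eventually (R : realType) (C e : R) : 0 < e ->
  exists n0, forall n, (n0 <= n)%N -> n.+1%:R^-1 * C <= e.
Proof.
move=> e0; exists (Num.truncn (C / e)) => n n0n.
rewrite ler_pdivrMl ?ltr0Sn// -ler_pdivrMr//.
by rewrite (le_trans (ltW (truncnS_gt _)))// ler_nat ltnS.
Qed.

Section MatrixModels.
Context (R : realType) (G : groupType) (N : groupClosed G).
Hypothesis nN : normal_subgroup N.
Hypothesis G_countable : countable [set: G].
Hypothesis G_amenable : amenable R G.
Context (eG : nat -> G) (eN : nat -> subgroup N).
Local Notation D := (dual R (subgroup N)).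
Local Notation act := (@dual_act R G N nN).
Context (mu : probability (borel D) R).
Hypothesis mu_inv : Defs.invariant act mu.

(** At precision k, f is multiplicative on the first k elements of the
enumeration eG and is diagonal on N with diagonal characters b; the uniform
distribution on b is tested only against functions whose modulus of continuity
is known at level k, which makes the error bound uniform. *)
Definition matrix_model k n (f : G -> 'M[R[i]]_n.+1) (b : 'I_n.+1 -> D) : Prop :=
  [/\ forall i j l, (i < k)%N -> (j < k)%N -> (l < k)%N ->
        eG l = (eG i * eG j)%g ->
        dHS (f (eG i) *m f (eG j)) (f (eG l)) ^+ 2 <= 8 / k.+1%:R,
      forall x, f (val x) = diag_mx (\row_i sval (b i) x)
    & forall (phi : D -> R) (B e : R), continuous phi ->
        (forall chi, `|phi chi| <= B) ->
        (forall chi psi,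
          `|phi chi - phi psi| <= e + k%:R * char_dist eN k chi psi) ->
        `|n.+1%:R^-1 * \sum_i phi (b i) -
          \int[mu]_(chi in [set: borel D]) phi chi| <= e + (1 + B) / k.+1%:R].

(** The sample lives in the induced representations of finitely many characters
y j. Averaging phi over the translates by the weights p gives a function Phi
with the same integral as phi, because mu is invariant; so the points y j have
to represent mu for functions like Phi, and their neighbourhoods V control
all translates that occur in p. *)
Lemma exists_matrix_model k : exists n0, forall n, (n0 <= n)%N ->
  exists f b, (forall g, f g \is unitarymx) /\ @matrix_model k n f b.
Proof.
pose d : R := k.+1%:R^-1.
have d0 : 0 < d by rewrite invr_gt0 ltr0Sn.
have d20 : 0 < d / 2 by rewrite divr_gt0.
have [qs [p [qs_uniq p0 p_supp p1 p_inv]]] :=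
  @amenable_reiter R G N G_countable G_amenable k (fun i => eG i) (d / 2) d20.
pose a := size qs; pose q (t : 'I_a) := tnth (in_tuple qs) t.
have q_inj : injective q.
  move=> t t'; rewrite /q !(tnth_nth (coset_of N 1%g)) => /eqP.
  by rewrite nth_uniq// => /eqP/val_inj.
have {}p_supp x : (forall t, q t != x) -> p x = 0.
  move=> qx; apply: p_supp; apply/negP => /(tnthP (in_tuple qs))[t xt].
  by have := qx t; rewrite /q -xt eqxx.
have {}p1 : \sum_t p (q t) = 1 by rewrite -p1 [RHS]big_tnth.
have {}p_inv (i : 'I_k) : \sum_t `|p (q t) - p (coset_act (eG i) (q t))| <= d / 2.
  by apply: le_trans (p_inv i); rewrite [leRHS]big_tnth.
(* The modulus of phi multiplies the cost by k, and k * d ^+ 2 <= d. *)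
pose del := d ^+ 2.
have del0 : 0 < del by rewrite exprn_gt0.
pose V chi := [set psi | forall t : 'I_a,
  char_dist eN k (act (val (q t)) chi) (act (val (q t)) psi) < del].
have oV chi : open (V chi).
  rewrite openE => psi Vpsi; have psiF : Filter (nbhs psi) by exact: nbhs_filter.
  apply: (@filter_forall _ _ _ (nbhs psi) psiF) => t.
  have c1 := @dual_act_continuous R G N nN (val (q t)) psi.
  have c2 := cvg_comp _ _ c1
    (@char_dist_continuous R _ eN k (act (val (q t)) chi) _).
  apply: (c2 [set r : R | r < del]); apply: open_nbhs_nbhs.
  by split; [exact: open_lt|exact: Vpsi].
have Vx chi : V chi chi by move=> t; rewrite char_dist_refl.
have [m [y [rho [rho0 rho1 yP]]]] := quantization (@dual_compact R _) mu oV Vx.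
have [n0 n0P] := @inv_mul_le_eventually R (2 * (a * m)%:R) _ d20.
exists n0 => n /n0P am_le.
have [w [w_inj w_esc w_avg]] := @weighted_sample R G _ (@coset_act G N) a m n.+1 q p rho
  (coset_of N 1%g) q_inj p0 p_supp p1 rho0 rho1.
(* The padding carries the trivial character. *)
pose xi (j : option 'I_m) : D := if j is Some j' then y j' else point.
pose oact g (x : coset N * (option 'I_m * nat)) := (coset_act g x.1, x.2).
pose c g (x : coset N * (option 'I_m * nat)) := sval (xi x.2.1) (coset_cocycle g x.1).
have [|||||f [fU fM fD]] := @monomial_almost_hom R G _ oact c n.+1 w.
- move=> g [x l] [x' l'] xx'.
  have /= /coset_act_inj -> := congr1 fst xx'.
  by have /= -> := congr1 snd xx'.
- by move=> g h x; rewrite /oact /= coset_actM.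
- by move=> g x; exact: character_norm.
- move=> g h x; rewrite /c coset_cocycleM /=.
  by have [_ ->] := set_mem (svalP (xi x.2.1)).
- exact: w_inj.
pose b i := act (val (w i).1) (xi (w i).2.1).
exists f, b; split=> //; split.
- move=> i j l ik jk lk lij.
  have := fM (eG i) (eG j); rewrite -lij => /le_trans le_f; apply: le_f.
  have esc (i' : nat) : (i' < k)%N -> n.+1%:R^-1 * #|escaping oact w (eG i')|%:R <= d.
    move=> ik'; have h : #|escaping oact w (eG i')|%:R <=
      n.+1%:R * (d / 2) + 2 * (a * m)%:R := w_esc _ _ (p_inv (Ordinal ik')).
    rewrite ler_pdivrMl ?ltr0Sn// (le_trans h)//.
    by rewrite [X in _ <= _ * X]splitr mulrDr lerD2l -ler_pdivrMl ?ltr0Sn.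
  have -> : 8 / k.+1%:R = 4 * (d + d) by rewrite /d; field.
  by rewrite mulrCA ler_wpM2l// mulrDr lerD// esc.
- move=> x; rewrite fD => [|i]; last by rewrite /oact coset_act_normal//; case: (w i).
  congr diag_mx; apply/rowP => i; rewrite !mxE /c /b /=.
  by rewrite (coset_cocycle_normal nN).
move=> phi B e cphi phiB phi_mod.
have B0 : 0 <= B by rewrite (le_trans _ (phiB point)).
pose psi (x : coset N) (j : option 'I_m) := phi (act (val x) (xi j)).
have {}w_avg := w_avg psi B (fun x j => phiB _).
pose Phi chi := \sum_t p (q t) * phi (act (val (q t)) chi).
have cphit t : continuous (fun chi => phi (act (val (q t)) chi)).
  by move=> chi; apply: continuous_comp; [exact: dual_act_continuous|exact: cphi].
have cPhi : continuous Phi by apply: (@continuous_lincomb R D).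
have intPhi : \int[mu]_(chi in [set: borel D]) Phi chi =
              \int[mu]_(chi in [set: borel D]) phi chi.
  rewrite /Phi (@Rintegral_lincomb R D (@dual_compact R _) mu a (fun t => p (q t))
    (fun t chi => phi (act (val (q t)) chi)) cphit).
  rewrite (eq_bigr (fun t => p (q t) * \int[mu]_(chi in [set: borel D]) phi chi)).
    by rewrite -mulr_suml p1 mul1r.
  move=> t _; congr (_ * _); apply: Rintegral_comp => //.
  - exact: dual_compact.
  - exact: dual_act_continuous.
  - by move=> A mA; exact: mu_inv.
have sumE : \sum_t \sum_j p (q t) * rho j * psi (q t) (Some j) =
            \sum_j rho j * Phi (y j).
  rewrite exchange_big /=; apply: eq_bigr => j _.
  by rewrite /Phi mulr_sumr; apply: eq_bigr => t _; rewrite mulrAC mulrC.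
have Phi_mod chi chi' : V chi chi' -> `|Phi chi - Phi chi'| <= e + d.
  move=> Vchi; rewrite /Phi -sumrB (le_trans (ler_norm_sum _ _ _))//.
  rewrite -[leRHS]mul1r -p1 mulr_suml; apply: ler_sum => t _.
  rewrite -mulrBr normrM ger0_norm// ler_wpM2l//.
  apply: le_trans (phi_mod _ _) _; rewrite lerD2l.
  have /ltW Vt := Vchi t.
  apply: le_trans (ler_wpM2l (ler0n _ k) Vt) _.
  rewrite /del expr2 mulrA ler_piMl ?(ltW d0)// ler_pdivrMr ?ltr0Sn// mul1r.
  by rewrite ler_nat.
have := yP Phi _ cPhi Phi_mod; rewrite intPhi -sumE.
set I1 := \int[mu]_(_ in _) _; set S1 := \sum_t _ => hI.
set S2 := \sum_i phi (b i) in w_avg *.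
have h2 : `|n.+1%:R^-1 * S2 - S1| <= d / 2 * B.
  have -> : n.+1%:R^-1 * S2 - S1 = n.+1%:R^-1 * (S2 - n.+1%:R * S1).
    by rewrite mulrBr mulKf.
  rewrite normrM ger0_norm ?invr_ge0//.
  apply: le_trans (ler_wpM2l _ w_avg) _; rewrite ?invr_ge0//.
  rewrite [leLHS](_ : _ = (n.+1%:R^-1 * (2 * (a * m)%:R)) * B); last by ring.
  exact: ler_wpM2r.
have := ler_distD S1 (n.+1%:R^-1 * S2) I1; rewrite (distrC S1 I1).
have : d / 2 * B <= d * B by rewrite ler_wpM2r//; lra.
rewrite [(1 + B) / _](_ : _ = d + d * B); last by rewrite /d; ring.
by lra.
Qed.

End MatrixModels.

(** * Simultaneous diagonalization *)

Section Diagonalization.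
Context (R : realType) (G : groupType) (N : groupClosed G).
Local Notation D := (dual R (subgroup N)).

(** A list whose span has maximal rank spans the whole family. *)
Lemma finite_spanning_subfamily (F : fieldType) (T : Type) m (v : T -> 'rV[F]_m) :
  exists s : seq T, forall x, (v x <= \sum_(y <- s) <<v y>>)%MS.
Proof.
apply: contrapT => /forallNP ns.
suff [s] : exists s : seq T, (m < \rank (\sum_(y <- s) <<v y>>)%MS)%N.
  by rewrite ltnNge rank_leq_col.
elim: m.+1 => [|k [s ks]]; first by exists [::].
have /existsNP[x /negP xs] := ns s.
exists (x :: s); rewrite big_cons; apply: leq_ltn_trans ks _.
apply: rank_ltmx; rewrite ltmxE addsmxSr /=.
by apply: contra xs; apply: submx_trans; rewrite (submx_trans _ (addsmxSl _ _))// genmxE.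
Qed.

(** A finite list spanning all phi x is triangularized in an orthonormal basis,
together with the inverses. Inverses of unitary matrices are adjoints, so the
matrices are both lower and upper triangular. *)
Lemma codiagonalization n (phi : G -> 'M[R[i]]_n) : unitary_hom phi ->
  abelian_subgroup N ->
  exists2 P : 'M[R[i]]_n, P \is unitarymx &
    forall x : subgroup N, is_diag_mx (P *m phi (val x) *m P^t*).
Proof.
move=> [phiU phiM] Nab.
have phi1 : phi 1%g = 1%:M.
  have := phiM 1%g 1%g; rewrite mulg1 => /(congr1 (mulmx (invmx (phi 1%g)))).
  by rewrite mulmxA mulVmx ?unitarymx_unit// mul1mx.
have phiV g : phi g^-1%g = (phi g)^t*.
  rewrite -invmx_unitary//; have := phiM g^-1%g g; rewrite mulVg phi1 => e.
  by rewrite -[RHS]mul1mx e mulmxK// unitarymx_unit.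
have phiC (x y : subgroup N) : comm_mx (phi (val x)) (phi (val y)).
  by rewrite /comm_mx -!phiM (Nab _ _ (valP x) (valP y)).
have [s sP] := finite_spanning_subfamily (fun x : subgroup N => mxvec (phi (val x))).
pose s' := s ++ [seq x^-1%g | x <- s].
have [|P PU Ptrig] := @cotrigonalization _ n [seq phi (val x) | x <- s'].
  by move=> _ _ /mapP[x _ ->] /mapP[y _ ->].
exists P => // x.
have trig y : y \in s' -> is_trig_mx (P *m phi (val y) *m P^t*).
  move=> ys; have := allP Ptrig _ (map_f (fun z : subgroup N => phi (val z)) ys).
  by rewrite -(conjymx _ PU).
have diag y : y \in s -> is_diag_mx (P *m phi (val y) *m P^t*).
  move=> ys; apply/is_diag_mxP => i j; rewrite neq_ltn => /orP[ij|ji].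
    by apply: (is_trig_mxP (trig y _)) => //; rewrite mem_cat ys.
  have /is_trig_mxP/(_ j i ji) : is_trig_mx (P *m phi (val y^-1%g) *m P^t*).
    by apply: trig; rewrite mem_cat map_f ?orbT.
  rewrite gmulfV phiV => h.
  have e : P *m (phi (val y))^t* *m P^t* = (P *m phi (val y) *m P^t*)^t*.
    by rewrite !trmx_mul !map_mxM /= !trmxCK mulmxA.
  by move: h; rewrite e !mxE => /eqP; rewrite conjC_eq0 => /eqP.
apply/is_diag_mxP => i j ij.
(* Being diagonal is a linear condition: the (i, j) entry after the change of
   basis is the linear form with matrix L. *)
pose L := (mxvec ((row i P)^T *m (col j (P^t*))^T))^T.
have LE y : mxvec (phi (val y)) *m L = ((P *m phi (val y) *m P^t*) i j)%:M.
  rewrite -[LHS]trmxK trmx_mul trmxK mxvec_dotmul trmxK -row_mul [X in X^T]mx11_scalar tr_scalar_mx; congr (_%:M).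
  by rewrite !mxE; apply: eq_bigr => k _; rewrite !mxE.
have : (mxvec (phi (val x)) <= kermx L)%MS.
  apply: submx_trans (sP x) _; rewrite big_seq_cond.
  elim/big_ind: _ => [|A B AL BL|y /andP[ys _]]; first exact: sub0mx.
    by rewrite addsmx_sub AL BL.
  rewrite genmxE; apply/sub_kermxP; rewrite LE.
  by rewrite (is_diag_mxP (diag y ys))// raddf0.
move=> /sub_kermxP; rewrite LE => /matrixP/(_ 0 0).
by rewrite !mxE eqxx mulr1n.
Qed.

End Diagonalization.

(** * Eigencharacters of unitary representations *)

Section UnitaryMatrices.
Context (R : realType).

Lemma unitarymx_adjK n (P : 'M[R[i]]_n) : P \is unitarymx -> P^t* *m P = 1%:M.
Proof. by move=> /unitarymxP/mulmx1C. Qed.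

Lemma unitarymx_row_sqmod n (P : 'M[R[i]]_n) i : P \is unitarymx ->
  \sum_j sqmod (P i j) = 1.
Proof.
move=> /unitarymxP/matrixP/(_ i i); rewrite !mxE eqxx mulr1n.
move=> /(congr1 (@complex.Re R)); rewrite raddf_sum /= => <-.
by apply: eq_bigr => j _; rewrite !mxE mulrC conjC_sqmod.
Qed.

Lemma unitarymx_col_sqmod n (P : 'M[R[i]]_n) j : P \is unitarymx ->
  \sum_i sqmod (P i j) = 1.
Proof.
move=> /unitarymx_adjK/matrixP/(_ j j); rewrite !mxE eqxx mulr1n.
move=> /(congr1 (@complex.Re R)); rewrite raddf_sum /= => <-.
by apply: eq_bigr => i _; rewrite !mxE conjC_sqmod.
Qed.

(** Otherwise every term of the Leibniz formula of the determinant vanishes. *)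
Lemma unit_permutation n (U : 'M[R[i]]_n) : U \in unitmx ->
  exists s : {perm 'I_n}, forall i, U i (s i) != 0.
Proof.
rewrite unitmxE unitfE => detU; apply: contrapT => /forallNP ns.
move: detU; rewrite /determinant big1 ?eqxx// => s _.
have /existsNP[i /negP] := ns s; rewrite negbK => /eqP Ui.
by rewrite (bigD1 i)//= Ui mul0r mulr0.
Qed.

Lemma intertwine_diag n (U : 'M[R[i]]_n) (a b : 'rV[R[i]]_n) i j :
  U *m diag_mx a = diag_mx b *m U -> U i j != 0 -> a 0 j = b 0 i.
Proof.
move=> /matrixP/(_ i j); rewrite mul_mx_diag mul_diag_mx !mxE mulrC.
by move=> e Uij; exact: (mulIf Uij).
Qed.

Lemma dHS_unitaryl n (P A B : 'M[R[i]]_n) : P \is unitarymx ->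
  dHS (P *m A) (P *m B) = dHS A B.
Proof.
move=> PU; rewrite /dHS -mulmxBr trmx_mul map_mxM -mulmxA (mulmxA (P^t*)).
by rewrite unitarymx_adjK// mul1mx.
Qed.

Lemma dHS_sqr_sym n (A B : 'M[R[i]]_n) : dHS A B ^+ 2 = dHS B A ^+ 2.
Proof.
rewrite !dHS_sqr; congr (_ * _).
by apply: eq_bigr => j _; apply: eq_bigr => i _; rewrite sqmodB.
Qed.

End UnitaryMatrices.

Section EmpiricalCharacters.
Context (R : realType) (G : groupType) (N : groupClosed G).
Hypothesis nN : normal_subgroup N.
Local Notation D := (dual R (subgroup N)).
Local Notation act := (@dual_act R G N nN).

Definition diagonalized_by n (phi : G -> 'M[R[i]]_n) (P : 'M[R[i]]_n) (c : 'I_n -> D) :=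
  P \is unitarymx /\
  forall x : subgroup N, P *m phi (val x) *m P^t* = diag_mx (\row_i sval (c i) x).

Lemma exists_diagonalization n (phi : G -> 'M[R[i]]_n) : unitary_hom phi ->
  abelian_subgroup N -> exists P c, @diagonalized_by n phi P c.
Proof.
move=> phiH Nab; have [P PU Pdiag] := codiagonalization phiH Nab.
have [phiU phiM] := phiH.
pose M (x : subgroup N) := P *m phi (val x) *m P^t*.
have ME x : M x = diag_mx (\row_i M x i i).
  apply/matrixP => i j; rewrite [RHS]mxE [in RHS]mxE.
  by have [->|ij] := eqVneq i j; [rewrite mulr1n|rewrite mulr0n (is_diag_mxP (Pdiag x))].
have MM x y : M (x * y)%g = M x *m M y.
  rewrite /M valM phiM !mulmxA; congr (_ *m _ *m _).
  by rewrite -[RHS]mulmxA unitarymx_adjK// mulmx1.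
have MU x : M x \is unitarymx.
  by rewrite /M !mul_unitarymx// trmxC_unitary.
have chiP i : is_character (fun x => M x i i).
  split=> [x|x y].
    have /unitarymxP/matrixP/(_ i i) := MU x.
    rewrite ME !mxE (bigD1 i)//= big1 => [|j /negbTE ji]; last first.
      by rewrite !mxE eq_sym ji mulr0n mul0r.
    rewrite !mxE !eqxx !mulr1n addr0 -normCK => h.
    by apply/eqP; rewrite -sqrp_eq1// h.
  by rewrite MM (ME x) (ME y) mulmx_diag !mxE eqxx !mulr1n.
by exists P, (fun i => mk_dual (chiP i)); split.
Qed.

(** The matrix of phi g in the eigenbasis intertwines the diagonal of the
eigencharacters with the diagonal of their translates by g, so a nonzero entry
(i, j) forces act g (c j) = c i; an invertible matrix has nonzero entries along
a permutation. *)
Lemma diagonalization_invariant n (phi : G -> 'M[R[i]]_n) P c g :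
  unitary_hom phi -> @diagonalized_by n phi P c ->
  exists s : {perm 'I_n}, forall i, act g (c (s i)) = c i.
Proof.
move=> [phiU phiM] [PU Pc].
(* U is the matrix of phi g in the eigenbasis. *)
pose U := P *m phi g *m P^t*.
have UU : U \is unitarymx by rewrite /U !mul_unitarymx// trmxC_unitary.
have [s sP] := unit_permutation (unitarymx_unit UU).
exists s => i; apply: dual_inj => x /=.
have : U *m (P *m phi (val (conj_subgroup nN g x)) *m P^t*) =
       (P *m phi (val x) *m P^t*) *m U.
  rewrite /U !mulmxA -[_ *m P^t* *m P]mulmxA unitarymx_adjK// mulmx1.
  rewrite -[_ *m P^t* *m P]mulmxA unitarymx_adjK// mulmx1.
  by rewrite -!(mulmxA P) -!phiM /= !mulgA mulgV mul1g.
rewrite !Pc => /intertwine_diag/(_ (sP i)).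
by rewrite !mxE.
Qed.

Lemma empirical_invariant n (phi : G -> 'M[R[i]]_n.+1) P c : unitary_hom phi ->
  @diagonalized_by n.+1 phi P c ->
  Defs.invariant act (empirical R c : probability (borel D) R).
Proof.
move=> phiH Pc g A mA /=; have [s sP] := diagonalization_invariant g phiH Pc.
rewrite !empiricalE; congr (_ * _)%:E.
rewrite (reindex_inj (@perm_inj _ s))/=; apply: eq_bigr => i _.
by rewrite !indicE -(sP i).
Qed.

(** A character different from all c i has values different from theirs at
finitely many elements, and this is an open condition. *)
Lemma finite_support_empirical n (c : 'I_n.+1 -> D) :
  finite_set (Defs.support (empirical R c : probability (borel D) R)).
Proof.
apply: (@sub_finite_set _ _ (range c)); last first.
  by apply: finite_image; exact: finite_finset.
move=> chi; apply: contraPP => nc supp.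
have /choice[x xP] i : exists x, sval chi x != sval (c i) x.
  apply: contrapT => /forallNP h; apply: nc; exists i => //.
  by apply: dual_inj => x; apply/esym/eqP/negPn/negP; exact: h.
pose U := [set psi : D | forall i, sval psi (x i) != sval (c i) (x i)].
have oU : open U.
  rewrite openE => psi Upsi; have psiF : Filter (nbhs psi) by exact: nbhs_filter.
  apply: (@filter_forall _ _ _ (nbhs psi) psiF) => i.
  have cl : closed [set sval (c i) (x i) : R[i]^o].
    apply: accessible_closed_set1; apply: hausdorff_accessible.
    exact: (@norm_hausdorff _ R[i]^o).
  have := @ev_continuous R _ (x i) psi (~` [set sval (c i) (x i) : R[i]^o]).
  case=> [|V [oV Vpsi] VU].
    by apply: open_nbhs_nbhs; split; [exact: closed_openC|exact/eqP/Upsi].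
  by exists V; split=> // xi /VU /= /eqP.
have := supp U oU xP; rewrite /= empiricalE big1 ?mulr0 ?ltxx// => i _.
rewrite indicE memNset// => /(_ i).
by rewrite eqxx.
Qed.

(** The coupling of c i and b j with mass sqmod (P i j) / n.+1 has total
char_dist-cost equal to the sum of the squared Hilbert-Schmidt distances: the
(i, j) entry of P (phi x - f x) is (c i x - b j x) P_ij, and P is unitary. *)
Lemma spectral_transport n (f phi : G -> 'M[R[i]]_n.+1) P (b c : 'I_n.+1 -> D)
    (eN : nat -> subgroup N) (k : nat) (psi : D -> R) (e : R) :
  @diagonalized_by n.+1 phi P c ->
  (forall x : subgroup N, f (val x) = diag_mx (\row_i sval (b i) x)) ->
  (forall chi chi', `|psi chi - psi chi'| <= e + k%:R * char_dist eN k chi chi') ->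
  `|n.+1%:R^-1 * \sum_i psi (c i) - n.+1%:R^-1 * \sum_j psi (b j)| <=
  e + k%:R * \sum_(l < k) dHS (f (val (eN l))) (phi (val (eN l))) ^+ 2.
Proof.
move=> [PU Pc] fb psi_mod.
have dHSE x : dHS (f (val x)) (phi (val x)) ^+ 2 =
    n.+1%:R^-1 * \sum_i \sum_j sqmod (P i j) * sqmod (sval (c i) x - sval (b j) x).
  rewrite dHS_sqr_sym -(dHS_unitaryl _ _ PU) dHS_sqr exchange_big/=; congr (_ * _).
  apply: eq_bigr => i _; apply: eq_bigr => j _.
  have -> : P *m phi (val x) = diag_mx (\row_i sval (c i) x) *m P.
    by rewrite -Pc -!mulmxA unitarymx_adjK// mulmx1.
  rewrite fb mul_mx_diag mul_diag_mx !mxE -sqmodM; congr sqmod.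
  by rewrite mulrBr mulrC.
have -> : \sum_i psi (c i) = \sum_i \sum_j sqmod (P i j) * psi (c i).
  by apply: eq_bigr => i _; rewrite -mulr_suml unitarymx_row_sqmod// mul1r.
have -> : \sum_j psi (b j) = \sum_i \sum_j sqmod (P i j) * psi (b j).
  rewrite exchange_big; apply: eq_bigr => j _.
  by rewrite -mulr_suml unitarymx_col_sqmod// mul1r.
rewrite -mulrBr normrM ger0_norm ?invr_ge0// ler_pdivrMl ?ltr0Sn//.
rewrite -sumrB (le_trans (ler_norm_sum _ _ _))//.
apply: (@le_trans _ _ (\sum_i \sum_j sqmod (P i j) *
    (e + k%:R * char_dist eN k (c i) (b j)))).
  apply: ler_sum => i _; rewrite -sumrB (le_trans (ler_norm_sum _ _ _))//.
  apply: ler_sum => j _; rewrite -mulrBr normrM ger0_norm ?sqmod_ge0//.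
  by rewrite ler_wpM2l ?sqmod_ge0.
rewrite le_eqVlt; apply/orP; left; apply/eqP.
under eq_bigr do under eq_bigr do rewrite mulrDr.
under eq_bigr do rewrite big_split/=.
rewrite big_split/= mulrDr; congr (_ + _).
  under eq_bigr do rewrite -mulr_suml unitarymx_row_sqmod// mul1r.
  by rewrite sumr_const card_ord mulr_natl.
under [in RHS]eq_bigr do rewrite dHSE.
rewrite -mulr_sumr mulrCA mulVKf//.
under eq_bigr do under eq_bigr do rewrite mulrCA.
under eq_bigr do rewrite -mulr_sumr.
rewrite -mulr_sumr; congr (_ * _).
rewrite [RHS]exchange_big/=; apply: eq_bigr => i _.
rewrite [RHS]exchange_big/=; apply: eq_bigr => j _.
by rewrite mulr_sumr.
Qed.

End EmpiricalCharacters.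

(** * Sequences *)

(** The precision kappa n is the largest k <= n whose threshold has been passed. *)
Lemma slow_diagonal (P : nat -> nat -> Prop) :
  (forall k, exists n0, forall n, (n0 <= n)%N -> P k n) ->
  exists kappa : nat -> nat, forall k, exists n0, forall n, (n0 <= n)%N ->
    (k <= kappa n)%N /\ P (kappa n) n.
Proof.
move=> /choice[n0 n0P].
pose ok n k := (k == 0)%N || (n0 k <= n)%N.
exists (fun n => \max_(k < n.+1 | ok n k) k) => k.
exists (maxn k (maxn (n0 k) (n0 0%N))) => n.
rewrite !geq_max => /and3P[kn nk n00].
have okk : ok n (Ordinal (kn : (k < n.+1)%N)) by rewrite /ok nk orbT.
split; first exact: (@leq_bigmax_cond _ (fun k : 'I_n.+1 => ok n k) (fun k => k : nat) _ okk).
have [|k' /= ok' ->] := @eq_bigmax_cond _ [pred k : 'I_n.+1 | ok n k] (fun k => k : nat).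
  by apply/card_gt0P; exists (Ordinal (kn : (k < n.+1)%N)).
apply: n0P; move: ok'; rewrite inE /ok => /orP[/eqP->|//].
exact: n00.
Qed.

Lemma countable_enumeration (T : Type) (x0 : T) : countable [set: T] ->
  exists en : nat -> T, forall x, exists i, en i = x.
Proof.
move=> /countable_injP[c cinj].
have /choice[en enP] i : exists x, (exists y, c y = i) -> c x = i.
  by have [[y yi]|ny] := pselect (exists y, c y = i); [exists y|exists x0].
exists en => x; exists (c x); apply: cinj; rewrite ?inE//.
by apply: enP; exists x.
Qed.

Lemma cvg_to0 (R : realType) (u : nat -> R) : (forall n, 0 <= u n) ->
  (forall e, 0 < e -> exists n0, forall n, (n0 <= n)%N -> u n <= e) ->
  u @ \oo --> (0 : R).
Proof.
move=> u0 ule; apply/cvgrPdist_le => e e0; have [n0 n0P] := ule e e0.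
exists n0 => // n /= /n0P; by rewrite sub0r normrN ger0_norm.
Qed.

(** * Density of periodic measures *)

Theorem proposition1 (R : realType) (G : groupType)
    (G_countable : countable [set: G])
    (G_amenable : amenable R G)
    (G_stable : HS_stable R G)
    (N : groupClosed G)
    (N_normal : normal_subgroup N)
    (N_abelian : abelian_subgroup N) :
  has_dense_periodic_measures R (@dual_act R G N N_normal).
Proof.
move=> mu mu_inv.
have [eG eGP] := countable_enumeration 1%g G_countable.
have [eN eNP] : exists en : nat -> subgroup N, forall x, exists i, en i = x.
  apply: (countable_enumeration 1%g); have /countable_injP[c cinj] := G_countable.
  apply/countable_injP; exists (c \o val) => x y _ _ /cinj xy.
  by apply: val_inj; apply: xy; rewrite inE.
pose model k n f b := @matrix_model R G N eG eN mu k n f b.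
have [kappa kappaP] := slow_diagonal
  (exists_matrix_model G_countable G_amenable eG eN mu_inv).
(* For small n no model of the required precision may exist; the identity
   serves as a default. *)
have FE n : exists F : (G -> 'M[R[i]]_n.+1) * ('I_n.+1 -> dual R (subgroup N)),
    (forall g, F.1 g \is unitarymx) /\
    ((exists f b, (forall g, f g \is unitarymx) /\ model (kappa n) n f b) ->
     model (kappa n) n F.1 F.2).
  have [[f [b [fU fb]]]|nfb] :=
    pselect (exists f b, (forall g, f g \is unitarymx) /\ model (kappa n) n f b).
    by exists (f, b).
  exists (fun=> 1%:M, fun=> point); split=> [g /=|/nfb//].
  by apply/unitarymxP; rewrite mul1mx trmx1 map_mx1.
pose F n := sval (cid (FE n)); have FP n := svalP (cid (FE n)).
pose f n := (F n).1; pose b n := (F n).2.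
have modelP k : exists n0, forall n, (n0 <= n)%N ->
    (k <= kappa n)%N /\ model (kappa n) n (f n) (b n).
  have [n0 n0P] := kappaP k; exists n0 => n /n0P[kk Pn]; split=> //.
  exact: (FP n).2.
have f_asym : asymptotic_hom f.
  split=> [n g|g h]; first exact: (FP n).1.
  have [[i ei] [[j ej] [l el]]] := (eGP g, (eGP h, eGP (g * h)%g)).
  apply: cvg_to0 => [n|e e0]; first exact: dHS_ge0.
  have [k1 k1P] := @inv_mul_le_eventually R 8 (e ^+ 2) (exprn_gt0 _ e0).
  (* The defect is controlled once kappa n exceeds the indices of g, h and g * h. *)
  have [n0 n0P] := modelP (maxn k1 (maxn i.+1 (maxn j.+1 l.+1))).
  exists n0 => n /n0P[]; rewrite !geq_max => /and4P[kk ik jk lk] [+ _ _].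
  move=> /(_ i j l ik jk lk); rewrite ei ej el => /(_ erefl) le8.
  rewrite -(@ler_pXn2r _ 2)// ?nnegrE ?dHS_ge0 ?(ltW e0)//.
  by rewrite (le_trans le8)// mulrC k1P.
have [phi [phiH f_phi]] := G_stable f f_asym.
have PcE n : exists Pc : 'M[R[i]]_n.+1 * ('I_n.+1 -> dual R (subgroup N)),
    diagonalized_by (phi n) Pc.1 Pc.2.
  have [P [c Pc]] := exists_diagonalization (phiH n) N_abelian.
  by exists (P, c).
pose Pc n := sval (cid (PcE n)); have PcP n := svalP (cid (PcE n)).
exists (fun n => empirical R (Pc n).2); split=> [n|psi cpsi].
  split; first exact: empirical_invariant (phiH n) (PcP n).
  exact: finite_support_empirical.
have cD := @dual_compact R (subgroup N).
have [B psiB] := continuous_bounded cD cpsi.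
apply/cvgrPdist_le => e e0.
have e40 : 0 < e / 4 by rewrite divr_gt0.
have [k kP] := char_dist_modulus eNP cpsi e40.
have [k1 k1P] := @inv_mul_le_eventually R (1 + B) _ e40.
have [n0 n0P] := modelP (maxn k k1).
pose V n := k%:R * \sum_(l < k) dHS (f n (val (eN l))) (phi n (val (eN l))) ^+ 2.
have S0 : (fun n => \sum_(l < k) dHS (f n (val (eN l))) (phi n (val (eN l))) ^+ 2)
    @ \oo --> \sum_(l < k) (0 * 0 : R).
  apply: (@cvg_big R _ +%R 0 xpredT _ _ \oo) => [|l _].
    by move=> z; apply: (@cvgD _ R^o); [exact: cvg_fst|exact: cvg_snd].
  have -> : (fun n => dHS (f n (val (eN l))) (phi n (val (eN l))) ^+ 2) =
      (fun n => dHS (f n (val (eN l))) (phi n (val (eN l))) *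
                dHS (f n (val (eN l))) (phi n (val (eN l)))).
    by apply/funext => n; rewrite expr2.
  by apply: cvgM; exact: f_phi.
have V0 : V @ \oo --> (0 : R).
  rewrite big1 in S0; last by move=> l _; rewrite mul0r.
  by rewrite -[0](mulr0 k%:R); apply: cvgM; [exact: cvg_cst|exact: S0].
near=> n.
have [kk [_ fb b_mu]] : (maxn k k1 <= kappa n)%N /\ model (kappa n) n (f n) (b n).
  by apply: n0P; near: n; exact: nbhs_infty_ge.
move: kk; rewrite geq_max => /andP[kk k1k].
have Vn : V n <= e / 4.
  have : `|V n| <= e / 4.
    by near: n; move/cvgr0Pnorm_le: V0; apply.
  by move=> /(le_trans (ler_norm _)).
rewrite Rintegral_empirical//.
have tr := spectral_transport (PcP n) fb kP.
have kP' chi chi' : `|psi chi - psi chi'| <=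
    e / 4 + (kappa n)%:R * char_dist eN (kappa n) chi chi'.
  rewrite (le_trans (kP _ _))// lerD2l ler_pM ?char_dist_ge0 ?ler_nat//.
  exact: char_dist_mono.
have := b_mu psi B (e / 4) cpsi psiB kP'.
have := k1P _ k1k; rewrite [_ * (1 + B)]mulrC.
set A1 := \int[mu]_(_ in _) _; set A2 := _ * \sum_i psi (b n i) in tr *.
set A3 := _ * \sum_i _ in tr *.
move=> h1 h2.
have := ler_distD A2 A1 A3; rewrite (distrC A1 A2) (distrC A2 A3).
move=> /le_trans; apply.
(* For mu against f: oscillation of psi and model error; for f against phi:
   oscillation of psi and transport cost. *)
have -> : e = (e / 4 + e / 4) + (e / 4 + e / 4) by field.
rewrite lerD//.
  by rewrite (le_trans h2)// lerD2l.
by rewrite (le_trans tr)// lerD2l.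
Unshelve. all: by end_near.
Qed.
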